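(* Let $A$ be a quasi-hereditary Artin algebra with standard modules $\Delta(1),\dots,\Delta(n)$ and canonical epimorphisms $\pi(i):P(i)\to\Delta(i)$. If $\mathcal{F}(\Delta)$ is finite, then $p(\Delta)\le\max\{\mathrm{dp}_\Delta(\pi(i)) : i=1,\dots,n\}$, where $p(\Delta)$ is the greatest level of a non-empty member of the postprojective partition of $\mathcal{F}(\Delta)$.
   Context: Modules are finitely generated right $A$-modules. Fix an ordering $S(1),\dots,S(n)$ of representatives of the isomorphism classes of simple $A$-modules, and let $P(i)$ be the projective cover of $S(i)$. The standard module $\Delta(i)$ is the largest factor module of $P(i)$ all of whose composition factors are of the form $S(j)$ with $j\le i$, and $\pi(i):P(i)\to\Delta(i)$ is the canonical epimorphism. $\mathcal{F}(\Delta)$ is the full subcategory of $\mathrm{mod}A$ of modules having a filtration with factors isomorphic to standard modules. $A$ is quasi-hereditary (for this ordering) if $S(i)$ occurs exactly once as a composition factor of $\Delta(i)$ for each $i$, and $A_A\in\mathcal{F}(\Delta)$. $\mathcal{F}(\Delta)$ is called finite if it contains only finitely many isomorphism classes of indecomposable modules. Postprojective partition: write $\mathfrak{C}=\mathcal{F}(\Delta)$. For a subcategory $\mathfrak{D}$ of $\mathfrak{C}$ (full, closed under direct summands), $\mathrm{add}\,\mathfrak{D}$ is the subcategory of all modules isomorphic to summands of finite direct sums of modules in $\mathfrak{D}$. A module $N\in\mathfrak{D}$ is splitting projective in $\mathfrak{D}$ if each epimorphism $M\to N$ with $M\in\mathrm{add}\,\mathfrak{D}$ splits, and $\mathbf{P}_0(\mathfrak{D})$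 denotes the indecomposable splitting projectives in $\mathfrak{D}$. For a subcategory $\mathcal{X}$, $\mathfrak{C}_{\mathcal{X}}$ consists of the objects of $\mathfrak{C}$ with no summands in $\mathcal{X}$. Put $\mathbf{P}_0(\Delta)=\mathbf{P}_0(\mathfrak{C})$ and $\mathbf{P}_k(\Delta)=\mathbf{P}_0(\mathfrak{C}_{\mathbf{P}_0(\Delta)\cup\cdots\cup\mathbf{P}_{k-1}(\Delta)})$ for $k\ge1$. It is known (Auslander–Smalø, Ringel) that for each $k<\infty$, $\mathbf{P}_k(\Delta)$ has finitely many isomorphism classes and every module in $\mathfrak{C}_{\mathbf{P}_0(\Delta)\cup\cdots\cup\mathbf{P}_{k-1}(\Delta)}$ is an epimorphic image of a module in $\mathrm{add}\,\mathbf{P}_k(\Delta)$. When $\mathcal{F}(\Delta)$ is finite, there exists $m\ge0$ with $\mathbf{P}_m(\Delta)\ne\emptyset$ and $\mathbf{P}_{m+1}(\Delta)=\emptyset$, and $p(\Delta):=m$. Depth: for $M,N\in\mathcal{F}(\Delta)$, $\mathrm{rad}_\Delta(M,N)$ is the set of $f\in\mathrm{Hom}_A(M,N)$ such that for every indecomposable $X\in\mathcal{F}(\Delta)$ and all $g:X\to M$, $h:N\to X$ the composite $hfg$ is not an isomorphism; $\mathrm{rad}_\Delta^m(M,N)$ is the set of finite sums of composites of $m$ morphisms in $\mathrm{rad}_\Delta$ between modules in $\mathcal{F}(\Delta)$. For $f:X\to Y$ in $\mathcal{F}(\Delta)$, $\mathrm{dp}_\Delta(f)=m\ge1$ if $f\in\mathrm{rad}_\Delta^m(X,Y)\setminus\mathrm{rad}_\Delta^{m+1}(X,Y)$;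 $\mathrm{dp}_\Delta(f)=0$ if $f\notin\mathrm{rad}_\Delta(X,Y)$; and $\mathrm{dp}_\Delta(f)=\infty$ if $f\in\bigcap_{m\ge1}\mathrm{rad}_\Delta^m(X,Y)$. *)

(* Defs.v *)
From HB Require Import structures.
From mathcomp Require Import all_boot all_order all_algebra.
From mathcomp Require Import boolp classical_sets constructive_ereal.
Set Implicit Arguments.
Unset Strict Implicit.
Unset Printing Implicit Defensive.
Import GRing.Theory.
Local Open Scope ring_scope.

(* The definitions are stated for left modules over a ring B. A right
   A-module is a left module over the converse ring B := A^c. *)

Section Modules.
Variable B : pzRingType.
Implicit Types M N L X : lmodType B.

Definition is_zero M := forall x : M, x = 0.

Definition is_epi M N (f : M -> N) := forall y, exists x, f x = y.

Definition isomorphic M N := exists f : {linear M -> N}, bijective f.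

Definition finitely_generated M :=
  exists (k : nat) (v : 'I_k -> M),
    forall x, exists c : 'I_k -> B, x = \sum_(j < k) c j *: v j.

Definition is_simple M :=
  ~ is_zero M /\
  forall U : {pred M}, submod_closed U ->
    (forall x, x \in U -> x = 0) \/ (forall x, x \in U).

Definition indecomposable M :=
  ~ is_zero M /\
  forall N L, isomorphic M (N * L)%type -> is_zero N \/ is_zero L.

Definition is_summand N M := exists L, isomorphic M (N * L)%type.

Definition is_projective M :=
  forall N L (g : {linear N -> L}) (f : {linear M -> L}),
    is_epi g -> exists h : {linear M -> N}, forall x, g (h x) = f x.

Definition is_projective_cover M N (f : {linear M -> N}) :=
  [/\ finitely_generated M, is_projective M, is_epi f
    & forall L (h : {linear L -> M}), is_epi (f \o h) -> is_epi h].

Fixpoint is_direct_sum_of (D : lmodType B -> Prop) (k : nat) M : Prop :=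
  if k is k'.+1 then
    exists N L,
      [/\ D N, is_direct_sum_of D k' L & isomorphic M (N * L)%type]
  else is_zero M.

Definition add_closure (D : lmodType B -> Prop) M :=
  exists k X, is_direct_sum_of D k X /\ is_summand M X.

(* Epimorphisms are taken in the module category, hence surjective. *)
Definition splitting_projective (D : lmodType B -> Prop) N :=
  D N /\
  forall M (f : {linear M -> N}), add_closure D M -> is_epi f ->
    exists s : {linear N -> M}, cancel s f.

Definition indec_splitting_projective (D : lmodType B -> Prop) N :=
  indecomposable N /\ splitting_projective D N.

Definition without_summands (C X : lmodType B -> Prop) M :=
  C M /\ forall N, X N -> ~ is_summand N M.

(* [levels_below C k] is the union of P_0, ..., P_(k-1). *)
Fixpoint levels_below (C : lmodType B -> Prop) (k : nat) X : Prop :=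
  if k is k'.+1 then
    levels_below C k' X \/
    indec_splitting_projective (without_summands C (levels_below C k')) X
  else False.

Definition postprojective_level (C : lmodType B -> Prop) (k : nat) :=
  indec_splitting_projective (without_summands C (levels_below C k)).

Definition is_finite_type (C : lmodType B -> Prop) :=
  exists (k : nat) (X : 'I_k -> lmodType B),
    forall M, C M -> indecomposable M -> exists j, isomorphic M (X j).

(* The value is 0 by default if there is no such m; such an m exists
   whenever C is the category of Delta-filtered modules and is of finite
   type. *)
Definition postprojective_length (C : lmodType B -> Prop) : nat :=
  xget 0%N [set m : nat | (exists X, postprojective_level C m X) /\
                          ~ (exists X, postprojective_level C m.+1 X)]%classic.

Definition in_rad (C : lmodType B -> Prop) M N (f : {linear M -> N}) :=
  [/\ C M, C N &
    forall X, C X -> indecomposable X ->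
    forall (g : {linear X -> M}) (h : {linear N -> X}),
      ~ bijective (h \o f \o g)].

(* Composites of m >= 1 radical morphisms; the case m = 0 is not used. *)
Fixpoint is_rad_composite (C : lmodType B -> Prop) (m : nat)
    M N (f : {linear M -> N}) : Prop :=
  match m with
  | 0 => False
  | 1 => in_rad C f
  | m'.+1 => exists L (g : {linear M -> L}) (h : {linear L -> N}),
      [/\ in_rad C g, is_rad_composite C m' h & forall x, f x = h (g x)]
  end.

Definition in_rad_pow (C : lmodType B -> Prop) (m : nat)
    M N (f : {linear M -> N}) :=
  exists (k : nat) (c : 'I_k -> {linear M -> N}),
    (forall j, is_rad_composite C m (c j)) /\
    (forall x, f x = \sum_(j < k) c j x).

(* The powers of the radical decrease, so the integer chosen by xget is
   unique; it exists in the last case. *)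
Definition depth (C : lmodType B -> Prop) M N (f : {linear M -> N}) :
    \bar int :=
  if `[< ~ in_rad C f >] then 0%:E
  else if `[< forall m : nat, (0 < m)%N -> in_rad_pow C m f >] then +oo%E
  else (Posz (xget 0%N [set m : nat | [/\ (0 < m)%N, in_rad_pow C m f
                                     & ~ in_rad_pow C m.+1 f]]%classic))%:E.

Section Families.
Variable n : nat.
Implicit Types S D : 'I_n -> lmodType B.

(* M has a chain of submodules whose successive factors, from the top, are
   isomorphic to F i for i running through w: if w = i :: w', the submodule
   M' is the kernel of an epimorphism M -> F i and is filtered by w'. When F
   lists the simple modules, such a chain is a composition series. *)
Fixpoint has_filtration (F : 'I_n -> lmodType B) (w : seq 'I_n) M : Prop :=
  if w is i :: w' then
    exists (M' : lmodType B) (f : {linear M' -> M}) (g : {linear M -> F i}),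
      [/\ injective f, is_epi g,
          (forall x, g x = 0 <-> exists y, f y = x)
        & has_filtration F w' M']
  else is_zero M.

Definition filtered F M := exists w, has_filtration F w M.

Definition simple_representatives S :=
  [/\ forall i, is_simple (S i),
      forall i j, isomorphic (S i) (S j) -> i = j
    & forall M, is_simple M -> exists i, isomorphic M (S i)].

Definition composition_factors_le S (i : 'I_n) M :=
  exists w, has_filtration S w M /\ all (fun j : 'I_n => (j <= i)%N) w.

(* L is the largest factor of M whose composition factors are among the S j
   with j <= i: every other such factor of M is a factor of L. *)
Definition is_largest_factor_le S (i : 'I_n) M L (p : {linear M -> L}) :=
  [/\ is_epi p, composition_factors_le S i L
    & forall N (q : {linear M -> N}), is_epi q ->
        composition_factors_le S i N -> forall x, p x = 0 -> q x = 0].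

Definition is_quasi_hereditary S D :=
  (forall i, exists w, has_filtration S w (D i) /\ count_mem i w = 1%N) /\
  filtered D B^o.

End Families.
End Modules.

Definition artinian (R : comNzRingType) :=
  forall I : nat -> {pred R^o},
    (forall k, submod_closed (I k)) ->
    (forall k, {subset I k.+1 <= I k}) ->
    exists N : nat, forall k, (N <= k)%N -> I k =i I N.

Definition is_artin_algebra (R : comNzRingType) (A : algType R) :=
  artinian R /\ @finitely_generated R A.

(* Main.v *)
Require Import Defs.
From HB Require Import structures.
From mathcomp Require Import all_boot all_order all_algebra.
From mathcomp Require Import zify.
From mathcomp Require Import boolp classical_sets constructive_ereal.
Set Implicit Arguments.
Unset Strict Implicit.
Unset Printing Implicit Defensive.
Import GRing.Theory.
Local Open Scope ring_scope.

(** Write C for the category of Delta-filtered modules, P_0, P_1, ... for its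
    postprojective partition, and C_k for the modules of C without summands in
    P_0, ..., P_(k-1).  Let m = p(Delta) > 0 and take X in P_m.  A filtration
    of X starts with an epimorphism X -> Delta(i), and since P(i) is projective,
    pi(i) factors as P(i) -> X -> Delta(i).  It is therefore enough to see that
    every map from a projective P of C to a module Y of C_k, k > 0, lies in rad^k
    ([projective_to_level]).  The module Y is an epimorphic image of a direct
    sum of modules Z in P_(k-1), and P lifts along this epimorphism; the maps
    P -> Z lie in rad^(k-1) by induction if k > 1, and the maps Z -> Y are radical,
    because an isomorphism on an indecomposable factoring through Z -> Y would
    make Z a summand of Y ([level_step_rad]).  For m = 0 the bound says that
    some depth is nonnegative, which holds as soon as n > 0; and n > 0 because
    A is a nonzero filtered module.

    Two facts carry this argument.

    Firstly, C is closed under direct summands ([filtered_retract]), hence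
    contains the modules P(i), which are summands of free modules.  The reason
    is that Delta(i) is projective among the modules with composition factors
    S(j), j <= i, so that in a Delta-filtration the standard modules of largest
    index can be moved to the bottom.  A filtered module thus has a layered
    structure: a submodule that is relatively projective and generated by
    copies of Delta(i) for the largest i, with a quotient of the same kind for
    smaller indices.  This description passes to retracts ([layered_retract])
    and gives back a Delta-filtration ([top_layer_filtered]).

    Secondly, every module of C_k is generated by the splitting projectives of
    C_k ([splitting_projectives_generate]).  Among the finitely many
    indecomposables of C_k choose a minimal set I that generates C_k.  If some
    X in I were not splitting projective, a nonsplit epimorphism onto X would
    show that X is the sum of the images of its nonautomorphisms and of the
    maps from the other members of I.  Long composites of nonautomorphisms of
    an indecomposable module of finite length vanish, by the argument of Harada
    and Sai ([nonauto_word_zero]), so iterating this expression shows that X is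
    generated by I without X ([nakayama]), against minimality.  The same
    vanishing shows that the endomorphism ring of X is local ([bij_add]), which
    makes the radical additive. *)

(** * Submodules and quotient modules *)

Section SubQuotient.
Variables (B : pzRingType) (M : lmodType B) (U : submodClosed M).

Definition submodule : Type := {x : M | x \in U}.
HB.instance Definition _ := SubChoice.on submodule.
HB.instance Definition _ := [SubChoice_isSubLmodule of submodule by <:].

Definition sub_incl : {linear submodule -> M} := val.

Lemma submodule_zmod : zmod_closed (fun x : M => x \in U).
Proof. exact: GRing.submod_closedB (GRing.submodClosedP U). Qed.

Let zU : zmodClosed M := HB.pack (fun x : M => x \in U)
  (GRing.isZmodClosed.Build M (fun x : M => x \in U) submodule_zmod).

Definition quotient : Type := Quotient.quot zU.
HB.instance Definition _ := GRing.Zmodule.on quotient.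

Definition quot_proj (x : M) : quotient := \pi_(Quotient.quot zU)%qT x.

Lemma quot_projE x y : quot_proj x = quot_proj y <-> x - y \in U.
Proof.
split=> [/eqP|xy]; first by rewrite -Quotient.idealrBE.
by apply/eqP; rewrite -Quotient.idealrBE.
Qed.

Lemma quot_projD x y : quot_proj (x + y) = quot_proj x + quot_proj y.
Proof. by rewrite /quot_proj piE. Qed.

Lemma quot_repr (u : quotient) : quot_proj (repr u) = u.
Proof. exact: reprK. Qed.

Definition quot_scale (a : B) (u : quotient) : quotient := quot_proj (a *: repr u).

Lemma quot_scaleE a x : quot_scale a (quot_proj x) = quot_proj (a *: x).
Proof.
by apply/quot_projE; rewrite -scalerBr rpredZ //; apply/quot_projE/quot_repr.
Qed.

Lemma quot_scaleA a b u : quot_scale a (quot_scale b u) = quot_scale (a * b) u.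
Proof. by rewrite -[u]quot_repr !quot_scaleE scalerA. Qed.

Lemma quot_scale1 : left_id 1 quot_scale.
Proof. by move=> u; rewrite -[u]quot_repr quot_scaleE scale1r. Qed.

Lemma quot_scaleDr : right_distributive quot_scale +%R.
Proof.
move=> a u v; rewrite -[u]quot_repr -[v]quot_repr -quot_projD !quot_scaleE.
by rewrite scalerDr quot_projD.
Qed.

Lemma quot_scaleDl u : {morph quot_scale^~ u : a b / a + b}.
Proof.
by move=> a b; rewrite -[u]quot_repr !quot_scaleE scalerDl quot_projD.
Qed.

HB.instance Definition _ := GRing.Zmodule_isLmodule.Build B quotient
  quot_scaleA quot_scale1 quot_scaleDr quot_scaleDl.

Lemma quot_proj_linear : linear quot_proj.
Proof. by move=> a x y; rewrite quot_projD -quot_scaleE. Qed.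

End SubQuotient.

Section Linear.
Variable B : pzRingType.
Implicit Types M N L K Q : lmodType B.

Definition lin M N (f : M -> N) (lf : linear f) : {linear M -> N} :=
  HB.pack f (GRing.isLinear.Build B M N *:%R f lf).

Lemma ker_closed M N (f : {linear M -> N}) :
  submod_closed (fun x : M => f x == 0).
Proof.
split=> [|a x y]; rewrite !unfold_in ?linear0 //.
by rewrite linearP => /eqP-> /eqP->; rewrite scaler0 addr0.
Qed.

Definition ker_pred M N (f : {linear M -> N}) : submodClosed M :=
  HB.pack (fun x : M => f x == 0)
    (GRing.isSubmodClosed.Build B M _ (ker_closed f)).

Lemma im_closed M N (f : {linear M -> N}) :
  submod_closed (fun y : N => `[< exists x, f x = y >]).
Proof.
split=> [|a y z]; rewrite !unfold_in.
  by apply/asboolP; exists 0; rewrite linear0.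
move=> /asboolP[u <-] /asboolP[v <-]; apply/asboolP.
by exists (a *: u + v); rewrite linearP.
Qed.

Definition im_pred M N (f : {linear M -> N}) : submodClosed N :=
  HB.pack (fun y : N => `[< exists x, f x = y >])
    (GRing.isSubmodClosed.Build B N _ (im_closed f)).
Definition Ker M N (f : {linear M -> N}) : lmodType B := submodule (ker_pred f).
Definition ker_incl M N (f : {linear M -> N}) : {linear Ker f -> M} :=
  locked (sub_incl (ker_pred f)).
Definition Im M N (f : {linear M -> N}) : lmodType B := submodule (im_pred f).
Definition im_incl M N (f : {linear M -> N}) : {linear Im f -> N} :=
  locked (sub_incl (im_pred f)).
Definition Coker M N (f : {linear M -> N}) : lmodType B := quotient (im_pred f).
Definition coker_proj M N (f : {linear M -> N}) : {linear N -> Coker f} :=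
  locked (lin (quot_proj_linear (im_pred f))).

End Linear.

(** * Exact sequences, factorizations and retracts *)

Section Exact.
Variable B : pzRingType.
Implicit Types M N L K Q U : lmodType B.

Lemma ker_inclP M N (f : {linear M -> N}) x :
  f x = 0 <-> exists y, ker_incl f y = x.
Proof.
rewrite /ker_incl -lock; split=> [/eqP fx0 | [y <-]]; last exact/eqP/(valP y).
by exists (exist _ x fx0).
Qed.

Lemma ker_incl0 M N (f : {linear M -> N}) y : f (ker_incl f y) = 0.
Proof. by apply/ker_inclP; exists y. Qed.

Lemma ker_incl_inj M N (f : {linear M -> N}) : injective (ker_incl f).
Proof. by rewrite /ker_incl -lock; exact: val_inj. Qed.

Lemma im_inclP M N (f : {linear M -> N}) y :
  (exists x, f x = y) <-> exists z, im_incl f z = y.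
Proof.
rewrite /im_incl -lock; split=> [fx | [z <-]]; last exact/asboolP/(valP z).
by exists (exist _ y (asboolT fx)).
Qed.

Lemma im_incl_inj M N (f : {linear M -> N}) : injective (im_incl f).
Proof. by rewrite /im_incl -lock; exact: val_inj. Qed.

Lemma coker_projP M N (f : {linear M -> N}) y :
  coker_proj f y = 0 <-> exists x, f x = y.
Proof.
rewrite -(linear0 (coker_proj f)) /coker_proj -lock.
split=> [/quot_projE|fx]; last by apply/quot_projE; rewrite subr0; exact/asboolP.
by rewrite subr0 => /asboolP.
Qed.

Lemma coker_proj_epi M N (f : {linear M -> N}) : is_epi (coker_proj f).
Proof.
by rewrite /coker_proj -lock => u; exists (repr u); exact: quot_repr.
Qed.

Lemma lin_inj M N (f : {linear M -> N}) :
  (forall x, f x = 0 -> x = 0) -> injective f.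
Proof.
move=> f0 x y fxy; apply/eqP; rewrite -subr_eq0; apply/eqP/f0.
by rewrite linearB fxy subrr.
Qed.

Lemma inj_epi_bij M N (f : {linear M -> N}) :
  injective f -> is_epi f -> bijective f.
Proof.
move=> fI /choice[g gK]; exists g => // x.
by apply: fI; rewrite gK.
Qed.

Lemma bij_epi M N (f : M -> N) : bijective f -> is_epi f.
Proof. by case=> g _ gK y; exists (g y). Qed.

Lemma factor_epi M N L (f : {linear M -> N}) (h : {linear M -> L}) :
  is_epi f -> (forall x, f x = 0 -> h x = 0) ->
  exists g : {linear N -> L}, forall x, g (f x) = h x.
Proof.
move=> /choice[s sK] fh.
have E x y : f x = f y -> h x = h y.
  move=> fxy; apply/eqP; rewrite -subr_eq0 -linearB; apply/eqP/fh.
  by rewrite linearB fxy subrr.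
have lg : linear (h \o s).
  by move=> a x y /=; rewrite -linearP; apply: E; rewrite linearP !sK.
by exists (lin lg) => x; apply: E; rewrite sK.
Qed.

Lemma factor_mono K M L (k : {linear K -> M}) (h : {linear L -> M}) :
  injective k -> (forall x, exists y, k y = h x) ->
  exists g : {linear L -> K}, forall x, k (g x) = h x.
Proof.
move=> kI /choice[g gK].
have lg : linear g by move=> a x y; apply: kI; rewrite linearP !gK linearP.
by exists (lin lg).
Qed.

Lemma bij_inverse M N (f : {linear M -> N}) : bijective f ->
  exists g : {linear N -> M}, cancel f g /\ cancel g f.
Proof.
move=> fB; have [g gP] : exists g : {linear N -> M}, forall x, f (g x) = idfun x.
  by apply: factor_mono => [|x]; [exact: bij_inj | exact: bij_epi].
by exists g; split=> // x; apply: (bij_inj fB); rewrite gP.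
Qed.

Lemma im_factor M N (f : {linear M -> N}) :
  exists e : {linear M -> Im f}, is_epi e /\ forall x, im_incl f (e x) = f x.
Proof.
have [|e eP] := factor_mono (h := f) (@im_incl_inj _ _ f).
  by move=> x; apply: (im_inclP f _).1; exists x.
exists e; split=> // z; have [x fx] := (im_inclP f _).2 (ex_intro _ z erefl).
by exists x; apply: im_incl_inj; rewrite eP.
Qed.

Lemma fst_linear M N : linear (fun p : (M * N)%type => p.1).
Proof. by []. Qed.
Lemma snd_linear M N : linear (fun p : (M * N)%type => p.2).
Proof. by []. Qed.
Definition pr1 M N : {linear (M * N)%type -> M} := lin (@fst_linear M N).
Definition pr2 M N : {linear (M * N)%type -> N} := lin (@snd_linear M N).
Lemma pair_linear L M N (f : {linear L -> M}) (g : {linear L -> N}) :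
  linear (fun x => (f x, g x)).
Proof. by move=> a x y; rewrite !linearP. Qed.
Definition pairing L M N f g : {linear L -> (M * N)%type} :=
  lin (@pair_linear L M N f g).
Lemma copair_linear L M N (f : {linear M -> L}) (g : {linear N -> L}) :
  linear (fun p : (M * N)%type => f p.1 + g p.2).
Proof. by move=> a x y; rewrite !linearP scalerDr addrACA. Qed.
Definition copairing L M N f g : {linear (M * N)%type -> L} :=
  lin (@copair_linear L M N f g).
Definition in1 M N : {linear M -> (M * N)%type} := pairing idfun \0.
Definition in2 M N : {linear N -> (M * N)%type} := pairing \0 idfun.

Definition ses U M Q (u : {linear U -> M}) (q : {linear M -> Q}) :=
  [/\ injective u, is_epi q & forall x, q x = 0 <-> exists y, u y = x].

Lemma ses_ker M Q (q : {linear M -> Q}) : is_epi q -> ses (ker_incl q) q.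
Proof. by split=> //; [exact: ker_incl_inj | exact: ker_inclP]. Qed.

Lemma ses_coker U M (u : {linear U -> M}) : injective u -> ses u (coker_proj u).
Proof. by split=> //; [exact: coker_proj_epi | exact: coker_projP]. Qed.

(** Summands are handled as retracts: these compose, and an isomorphic copy of a
    module is one of its retracts, so closure under retracts gives invariance
    under isomorphism as well. *)
Definition retract N M :=
  exists (i : {linear N -> M}) (r : {linear M -> N}), cancel i r.

Lemma iso_retract M N (f : {linear M -> N}) : bijective f -> retract M N.
Proof. by case/bij_inverse => g [fK _]; exists f, g. Qed.

Lemma iso_sym M N : isomorphic M N -> isomorphic N M.
Proof. by case=> f /bij_inverse[g [fK gK]]; exists g, f. Qed.

Lemma iso_refl M : isomorphic M M.
Proof. by exists idfun, id. Qed.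

Lemma iso_trans M N L : isomorphic M N -> isomorphic N L -> isomorphic M L.
Proof. by move=> [f fB] [g gB]; exists (g \o f); apply: bij_comp. Qed.

(** The complement of the image of a section is the kernel of the retraction. *)
Lemma retract_split N M (i : {linear N -> M}) (r : {linear M -> N}) :
  cancel i r -> isomorphic M (N * Ker r)%type.
Proof.
move=> iK; have [|p pP] := factor_mono (h := idfun \- (i \o r)) (@ker_incl_inj _ _ r).
  by move=> x; apply/ker_inclP; rewrite /= linearB iK subrr.
exists (pairing r p); apply: inj_epi_bij => [|[a b]].
  apply: lin_inj => x [rx px].
  by have := pP x; rewrite /= rx px !linear0 addr0 => <-.
have rE : r (i a + ker_incl r b) = a by rewrite linearD iK ker_incl0 addr0.
exists (i a + ker_incl r b) => /=; congr pair => //.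
by apply: ker_incl_inj; rewrite pP /= rE addrAC subrr add0r.
Qed.

Lemma summand_retract N M : is_summand N M <-> retract N M.
Proof.
split=> [[L [f /bij_inverse[g [fK gK]]]] | [i [r iK]]].
  by exists (g \o in1 N L), (pr1 N L \o f) => x /=; rewrite gK.
by exists (Ker r); apply: retract_split iK.
Qed.

Lemma retract_trans N M L : retract N M -> retract M L -> retract N L.
Proof.
move=> [i [r iK]] [j [s jK]]; exists (j \o i), (r \o s).
by move=> x /=; rewrite jK iK.
Qed.

Lemma is_zero_inj M N (f : {linear M -> N}) :
  injective f -> is_zero N -> is_zero M.
Proof. by move=> fI N0 x; apply: fI; rewrite linear0; exact: N0. Qed.

Lemma is_zero_epi M N (f : {linear M -> N}) :
  is_epi f -> is_zero M -> is_zero N.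
Proof. by move=> fE M0 y; have [x <-] := fE y; rewrite (M0 x) linear0. Qed.

End Exact.

(** * Filtrations and composition length *)

Section Filtrations.
Variables (B : pzRingType) (n : nat).
Implicit Types M N L K Q U : lmodType B.
Implicit Types (F : 'I_n -> lmodType B) (w : seq 'I_n).

Lemma has_filtration_iso F w M N :
  isomorphic M N -> has_filtration F w M -> has_filtration F w N.
Proof.
case: w => [|i w] [h hB] /= FM.
  exact: is_zero_epi (bij_epi hB) FM.
have [k [hK kK]] := bij_inverse hB.
have [M' [f [g [fI gE fgE FM']]]] := FM.
exists M', (h \o f), (g \o k); split=> //.
- exact/inj_comp/fI/bij_inj.
- by move=> y; have [x <-] := gE y; exists (h x); rewrite /= hK.
- move=> x; split=> [/fgE[y yP]|[y <-]] /=; first by exists y; rewrite /= yP kK.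
  by rewrite hK; apply/fgE; exists y.
Qed.

(** The filtration of M runs through the preimages of the filtration of Q, then
    through U. *)
Lemma has_filtration_cat F w1 w2 U M Q (u : {linear U -> M}) (q : {linear M -> Q}) :
  ses u q -> has_filtration F w1 U -> has_filtration F w2 Q ->
  has_filtration F (w2 ++ w1) M.
Proof.
move=> + FU; elim: w2 M Q u q => [|i w2 IH] M Q u q [uI qE uqE] /= FQ.
  apply: has_filtration_iso FU; exists u; apply: inj_epi_bij => // x.
  by apply/uqE.
have [Q' [f [g [fI gE fgE FQ']]]] := FQ.
pose k := ker_incl (g \o q).
have kP x : g (q x) = 0 <-> exists y, k y = x := @ker_inclP _ _ _ (g \o q) x.
have kI : injective k := @ker_incl_inj _ _ _ (g \o q).
clearbody k.
exists (Ker (g \o q)), k, (g \o q); split=> //.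
  by move=> y; have [z <-] := gE y; have [x <-] := qE z; exists x.
have [|u' u'P] := factor_mono (h := u) kI.
  by move=> y; apply/kP; rewrite (_ : q _ = 0) ?linear0 //; apply/uqE; exists y.
have [|q' q'P] := factor_mono (h := q \o k) fI.
  by move=> y; apply/fgE/kP; exists y.
apply: (IH _ _ u' q') FQ'; split.
- by move=> x y /(congr1 k); rewrite !u'P => /uI.
- move=> z; have [x xP] := qE (f z).
  have /kP[y yx] : g (q x) = 0 by apply/fgE; exists z.
  by exists y; apply: fI; rewrite q'P -xP -yx.
- move=> y; split=> [y0|[z <-]]; last first.
    apply: fI; rewrite q'P linear0 /= u'P; apply/uqE; by exists z.
  have /uqE[z zP] : q (k y) = 0 by rewrite -[LHS]q'P y0 linear0.
  by exists z; apply: kI; rewrite u'P.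
Qed.

Lemma simple_image M (S0 : lmodType B) (f : {linear M -> S0}) :
  is_simple S0 -> (forall x, f x = 0) \/ is_epi f.
Proof.
case=> _ /(_ _ (GRing.submodClosedP (im_pred f)))[f0|fE]; [left=> x|right=> y].
  by apply: f0; apply/asboolP; exists x.
exact/asboolP/fE.
Qed.

(** Intersect the first submodule M' of the filtration of M with U.  As the factor
    M / M' is simple, it is a factor either of U or of Q, and the exact sequence
    induced on M' is treated by induction. *)
Lemma has_filtration_ses S w U M Q (u : {linear U -> M}) (q : {linear M -> Q}) :
  (forall i, is_simple (S i)) -> ses u q -> has_filtration S w M ->
  exists w1 w2, [/\ has_filtration S w1 U, has_filtration S w2 Q
    & perm_eq (w1 ++ w2) w].
Proof.
move=> Ss; elim: w U M Q u q => [|i w IH] U M Q u q [uI qE uqE] /=.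
  move=> M0; exists [::], [::]; split=> //; first exact: is_zero_inj uI M0.
  exact: is_zero_epi qE M0.
case=> M' [m [g [mI gE mgE FM']]].
have [gu0|guE] := simple_image (g \o u) (Ss i).
- have [|u' u'P] := factor_mono (h := u) mI; first by move=> x; apply/mgE/gu0.
  have [e [eE eP]] := im_factor (q \o m).
  have [|w1 [w2 [FU FQ' w12]]] := IH U M' (Im (q \o m)) u' e _ FM'.
    split=> //; first by move=> x y /(congr1 m); rewrite !u'P => /uI.
    move=> x; split=> [ex|[y <-]].
      have /uqE[y yP] : q (m x) = 0 by rewrite -[LHS]eP ex linear0.
      by exists y; apply: mI; rewrite u'P.
    by apply: im_incl_inj; rewrite eP [RHS]linear0 /= u'P; apply/uqE; exists y.
  have [|g' g'P] := factor_epi (h := g) qE; first by move=> x /uqE[y <-]; exact: gu0.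
  exists w1, (i :: w2); split=> //=; last by rewrite -(cat1s i) perm_catCA /= perm_cons.
  exists (Im (q \o m)), (im_incl (q \o m)), g'; split=> //.
  + exact: im_incl_inj.
  + by move=> y; have [x <-] := gE y; exists (q x); rewrite g'P.
  + move=> x; split=> [|[y <-]].
      have [z <-] := qE x; rewrite g'P => /mgE[y <-].
      by apply: (im_inclP (q \o m) _).1; exists y.
    have [z <-] := eE y; rewrite eP /= g'P; apply/mgE; by exists z.
- pose k := ker_incl (g \o u).
  have kP x : g (u x) = 0 <-> exists y, k y = x := @ker_inclP _ _ _ (g \o u) x.
have kI : injective k := @ker_incl_inj _ _ _ (g \o u).
clearbody k.
  have [|u' u'P] := factor_mono (h := u \o k) mI.
    by move=> x; apply/mgE/kP; exists x.
  have [|w1 [w2 [FU FQ w12]]] := IH _ M' Q u' (q \o m) _ FM'.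
    split.
    + by move=> x y /(congr1 m); rewrite !u'P => /uI/kI.
    + move=> y; have [x <-] := qE y; have [a aP] := guE (g x).
      have /mgE[z zP] : g (x - u a) = 0 by rewrite linearB [g (u a)]aP subrr.
      exists z; rewrite /= zP linearB (_ : q (u a) = 0) ?subr0 //.
      by apply/uqE; exists a.
    + move=> x; split=> [/uqE[y yP]|[y <-]].
        have /kP[z zP] : g (u y) = 0 by rewrite yP; apply/mgE; exists x.
        by exists z; apply: mI; rewrite u'P /= zP.
      by rewrite /= u'P; apply/uqE; exists (k y).
  exists (i :: w1), w2; split=> //=; last by rewrite perm_cons.
  by exists (Ker (g \o u)), k, (g \o u).
Qed.

Section Length.
Variable S : 'I_n -> lmodType B.
Hypothesis Ssimple : forall i, is_simple (S i).

Definition finite_length M := filtered S M.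

Definition has_filtration_of_size M (k : nat) : bool :=
  `[< exists2 w, has_filtration S w M & size w = k >].

(** The least size of a filtration by simple modules, which for modules of finite
    length is the composition length.  [has_filtration_cat] and
    [has_filtration_ses] give the two inequalities in its additivity on exact
    sequences. *)
Definition len M : nat :=
  xget 0%N [set k | has_filtration_of_size M k /\
    forall k', has_filtration_of_size M k' -> (k <= k')%N]%classic.

Lemma len_spec M : finite_length M ->
  (exists2 w, has_filtration S w M & size w = len M) /\
  forall w, has_filtration S w M -> (len M <= size w)%N.
Proof.
case=> w FM; rewrite /len.
have ex : exists k, has_filtration_of_size M k.
  by exists (size w); apply/asboolP; exists w.
case: xgetP => [k -> [/asboolP kM kmin]|].
  by split=> // w' Fw'; apply: kmin; apply/asboolP; exists w'.
move=> /(_ (ex_minn ex)); case; case: ex_minnP => k kM kmin.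
by split.
Qed.

Section Ses.
Variables (U M Q : lmodType B) (u : {linear U -> M}) (q : {linear M -> Q}).
Hypothesis uq : ses u q.

Lemma finite_length_sub : finite_length M -> finite_length U.
Proof. by case=> w /(has_filtration_ses Ssimple uq)[w1 [w2 [F1 _ _]]]; exists w1. Qed.

Lemma finite_length_quot : finite_length M -> finite_length Q.
Proof. by case=> w /(has_filtration_ses Ssimple uq)[w1 [w2 [_ F2 _]]]; exists w2. Qed.

Lemma len_ses : finite_length M -> len M = (len U + len Q)%N.
Proof.
move=> FM; apply/eqP; rewrite eqn_leq; apply/andP; split.
  have [[w1 F1 <-] _] := len_spec (finite_length_sub FM).
  have [[w2 F2 <-] _] := len_spec (finite_length_quot FM).
  by rewrite addnC -size_cat; apply: (len_spec FM).2; exact: has_filtration_cat uq F1 F2.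
have [[w Fw <-] _] := len_spec FM.
have [w1 [w2 [F1 F2 /perm_size <-]]] := has_filtration_ses Ssimple uq Fw.
rewrite size_cat leq_add //.
  by apply: (len_spec (finite_length_sub FM)).2.
by apply: (len_spec (finite_length_quot FM)).2.
Qed.

End Ses.

Lemma len0 M : finite_length M -> (len M == 0%N) <-> is_zero M.
Proof.
move=> FM; have [[w Fw wE] wmin] := len_spec FM; split=> [/eqP l0|M0].
  by case: w Fw wE => //= i w; rewrite l0.
by rewrite -leqn0; apply: (wmin [::]).
Qed.

Section Maps.
Variables (M N : lmodType B) (f : {linear M -> N}).

Lemma finite_length_inj : injective f -> finite_length N -> finite_length M.
Proof. by move=> fI; apply: finite_length_sub (ses_coker fI). Qed.

Lemma len_inj : injective f -> finite_length N -> (len M <= len N)%N.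
Proof. by move=> fI FN; rewrite (len_ses (ses_coker fI)) // leq_addr. Qed.

Lemma len_epi : is_epi f -> finite_length M -> (len N <= len M)%N.
Proof. by move=> fE FM; rewrite (len_ses (ses_ker fE)) // leq_addl. Qed.

Lemma inj_len_epi :
  injective f -> finite_length N -> (len N <= len M)%N -> is_epi f.
Proof.
move=> fI FN; have s := ses_coker fI; have FQ := finite_length_quot s FN.
rewrite (len_ses s FN) -{2}[len M]addn0 leq_add2l leqn0 => /(len0 FQ) Q0 y.
exact/coker_projP/Q0.
Qed.

Lemma epi_len_inj :
  is_epi f -> finite_length M -> (len M <= len N)%N -> injective f.
Proof.
move=> fE FM; have s := ses_ker fE; have FK := finite_length_sub s FM.
rewrite (len_ses s FM) -{2}[len N]add0n leq_add2r leqn0 => /(len0 FK) K0.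
by apply: lin_inj => x /ker_inclP[y <-]; rewrite (K0 y) linear0.
Qed.

End Maps.

End Length.
End Filtrations.

(** * Endomorphisms of indecomposable modules of finite length *)

Section Endomorphisms.
Variables (B : pzRingType) (n : nat) (S : 'I_n -> lmodType B).
Hypothesis Ssimple : forall i, is_simple (S i).
Implicit Types M N L K Q U : lmodType B.

Local Notation fl := (finite_length S).
Local Notation len := (len S).

Section Rank.
Variables (M N L : lmodType B) (f : {linear M -> L}).
Variables (h : {linear N -> L}) (g : {linear M -> N}).
Hypothesis fE : forall x, f x = h (g x).

Lemma im_comp_epi : exists e : {linear Im g -> Im f},
  is_epi e /\ forall z, im_incl f (e z) = h (im_incl g z).
Proof.
have [|e eP] := factor_mono (h := h \o im_incl g) (@im_incl_inj _ _ _ f).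
  move=> z; apply: (im_inclP f _).1 => /=.
  by have [x <-] := (im_inclP g _).2 (ex_intro _ z erefl); exists x.
exists e; split=> // z.
have [x xz] := (im_inclP f _).2 (ex_intro _ z erefl).
have [t tx] := (im_inclP g _).1 (ex_intro _ x erefl).
by exists t; apply: im_incl_inj; rewrite eP /= -xz fE -tx.
Qed.

Lemma im_comp_inj : exists2 k : {linear Im f -> Im h},
  injective k & forall z, im_incl h (k z) = im_incl f z.
Proof.
have [|k kP] := factor_mono (h := im_incl f) (@im_incl_inj _ _ _ h).
  move=> z; apply: (im_inclP h _).1.
  by have [x <-] := (im_inclP f _).2 (ex_intro _ z erefl); exists (g x).
exists k => // x y /(congr1 (im_incl h)); rewrite !kP; exact: im_incl_inj.
Qed.

Lemma finite_length_im : fl L -> fl (Im f).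
Proof. exact/finite_length_inj/im_incl_inj. Qed.

Lemma rank_comp_r : fl N -> (len (Im f) <= len (Im g))%N.
Proof.
move=> FN; have [e [eE _]] := im_comp_epi; apply: len_epi eE _ => //.
by apply: finite_length_inj FN => //; exact: im_incl_inj.
Qed.

(** The map induced by h from the image of g to the image of f = h g is onto, so it
    is injective when the two lengths agree. *)
Lemma rank_comp_r_eq x : fl N -> (len (Im g) <= len (Im f))%N ->
  h (g x) = 0 -> g x = 0.
Proof.
move=> FN le; have [e [eE eP]] := im_comp_epi => hgx.
have eI : injective e.
  apply: epi_len_inj eE _ le => //.
  by apply: finite_length_inj FN => //; exact: im_incl_inj.
have [t tx] := (im_inclP g _).1 (ex_intro _ x erefl).
suff t0 : t = 0 by rewrite -tx t0 linear0.
by apply: eI; apply: im_incl_inj; rewrite eP tx hgx !linear0.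
Qed.

(** The image of f = h g lies in the image of h, and is all of it when the two
    lengths agree. *)
Lemma rank_comp_l_eq y : fl L -> (len (Im h) <= len (Im f))%N ->
  exists x, h y = f x.
Proof.
move=> FL le; have [k kI kP] := im_comp_inj.
have kE : is_epi k.
  apply: inj_len_epi kI _ le => //.
  by apply: finite_length_inj FL => //; exact: im_incl_inj.
have [t ty] := (im_inclP h _).1 (ex_intro _ y erefl).
have [z zt] := kE t; have [x xz] := (im_inclP f _).2 (ex_intro _ z erefl).
by exists x; rewrite -ty -zt kP xz.
Qed.

End Rank.

Fixpoint nonauto_word (X : lmodType B) (m : nat) (f : {linear X -> X}) : Prop :=
  if m is m'.+1 then
    exists p g : {linear X -> X},
      [/\ ~ bijective p, nonauto_word m' g & forall x, f x = p (g x)]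
  else forall x, f x = x.

Lemma nonauto_word_split (X : lmodType B) a b (f : {linear X -> X}) :
  nonauto_word (a + b) f -> exists h g : {linear X -> X},
    [/\ nonauto_word a h, nonauto_word b g & forall x, f x = h (g x)].
Proof.
elim: a f => [|a IH] f /=; first by move=> fw; exists idfun, f.
case=> p [f' [pN /IH[h [g [hw gw f'E]]] fE]].
exists (p \o h), g; split=> //; first by exists p, h.
by move=> x; rewrite fE f'E.
Qed.

Lemma nonauto_word_cat (X : lmodType B) a b (f g : {linear X -> X}) :
  nonauto_word a f -> nonauto_word b g -> nonauto_word (a + b) (f \o g).
Proof.
move=> + gw; elim: a f => [|a IH] f /=.
  move=> f1; case: b gw => [|b] /= gw; first by move=> x; rewrite f1 gw.
  by have [p [h [pN hw gE]]] := gw; exists p, h; split=> // x; rewrite /= f1 gE.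
case=> p [h [pN hw fE]]; exists p, (h \o g); split=> //=; exact: IH.
Qed.

Section Indecomposable.
Variable X : lmodType B.
Hypotheses (Xi : indecomposable X) (FX : fl X).

Lemma endo_inj_bij (f : {linear X -> X}) : injective f -> bijective f.
Proof. by move=> fI; apply: inj_epi_bij => //; apply: inj_len_epi fI FX _. Qed.

(** The argument of Harada and Sai, on one module.  If composites of m
    nonautomorphisms have rank at most len X - r, consider a composite h p g of
    2m + 1 of them, with h and g of length m.  If its rank were equal to
    len X - r, so would be those of g and h, hence X would be the direct sum of
    the image of g and the kernel of h p.  The first is nonzero, so the second
    is zero, and p is injective, hence bijective. *)
Lemma nonauto_word_rank r : (r <= len X)%N ->
  exists m, forall f : {linear X -> X}, nonauto_word m f ->
    (len (Im f) + r <= len X)%N.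
Proof.
elim: r => [_|r IH rX].
  exists 0%N => f _; rewrite addn0.
  by apply: len_inj FX => //; exact: im_incl_inj.
have [m mP] := IH (ltnW rX).
exists (m + (1 + m))%N => f /nonauto_word_split[h [f1 [hw + fE]]].
case/nonauto_word_split=> psi [g [[p [i [pN iE psiE]]] gw f1E]].
have {}psiE x : psi x = p x by rewrite psiE iE.
rewrite leqNgt; apply/negP; rewrite addnS ltnS => rk.
have fag x : f x = (h \o p) (g x) by rewrite fE f1E psiE.
have fh x : f x = h ((p \o g) x) by exact: fag.
have gf : (len (Im g) <= len (Im f))%N.
  by rewrite -(leq_add2r r) (leq_trans (mP _ gw)).
have hf : (len (Im h) <= len (Im f))%N.
  by rewrite -(leq_add2r r) (leq_trans (mP _ hw)).
have aI x : h (p (g x)) = 0 -> g x = 0.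
  by move=> E; apply: (rank_comp_r_eq fag FX gf).
have aE x : exists y, h (p x) = h (p (g y)).
  have [y yP] := rank_comp_l_eq fh (p x) FX hf.
  by exists y; rewrite yP fE f1E psiE.
have iso : isomorphic X (Im g * Ker (h \o p))%type.
  apply: iso_sym; exists (copairing (im_incl g) (ker_incl (h \o p))).
  apply: inj_epi_bij => [|x].
    apply: lin_inj => -[z k] /= zk.
    have [x xz] := (im_inclP g _).2 (ex_intro _ z erefl).
    have zk' : im_incl g z = - ker_incl (h \o p) k.
      by apply/eqP; rewrite -addr_eq0; apply/eqP.
    have z0 : im_incl g z = 0.
      rewrite -xz; apply: aI; rewrite xz zk'.
      by rewrite -[LHS]/((h \o p) (- ker_incl (h \o p) k)) linearN ker_incl0 oppr0.
    have k0 : ker_incl (h \o p) k = 0 by rewrite -[LHS]opprK -zk' z0 oppr0.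
    congr pair; first by apply: im_incl_inj; rewrite z0 [RHS]linear0.
    by apply: ker_incl_inj; rewrite k0 [RHS]linear0.
  have [y yP] := aE x.
  have [z zP] := (im_inclP g _).1 (ex_intro _ y erefl).
  have [|k kP] := (@ker_inclP _ _ _ (h \o p) (x - g y)).1.
    by rewrite linearB /= yP subrr.
  by exists (z, k); rewrite /= zP kP addrC subrK.
have [Ig0|Ka0] := Xi.2 _ _ iso.
  have : len (Im f) = 0%N.
    apply/eqP; rewrite -leqn0 (leq_trans (rank_comp_r fag FX)) // leqn0.
    exact/(len0 (finite_length_im g FX)).
  by move=> f0; move: rk; rewrite f0 add0n leqNgt rX.
case: pN; apply: endo_inj_bij; apply: lin_inj => x px.
have [|k <-] := (@ker_inclP _ _ _ (h \o p) x).1; first by rewrite /= px linear0.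
by rewrite (Ka0 k) linear0.
Qed.

Lemma nonauto_word_zero :
  exists m, forall f : {linear X -> X}, nonauto_word m f -> forall x, f x = 0.
Proof.
have [m mP] := nonauto_word_rank (leqnn _); exists m => f /mP fm x.
have If0 : is_zero (Im f).
  apply/(len0 (finite_length_im f FX)).
  by rewrite -leqn0 -(leq_add2r (len X)) add0n.
by have [z <-] := (im_inclP f _).1 (ex_intro _ x erefl); rewrite (If0 z) linear0.
Qed.

Lemma nonauto_nilpotent (p : {linear X -> X}) : ~ bijective p ->
  exists m, forall x, iter m p x = 0.
Proof.
move=> pN; have [m m0] := nonauto_word_zero; exists m => x.
suff [f [fw <-]] : exists f : {linear X -> X}, nonauto_word m f /\ f x = iter m p x.
  exact: m0.
elim: (m) {m0} => [|k [f [fw fE]]]; first by exists idfun.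
by exists (p \o f); split; [exists p, f | rewrite /= fE].
Qed.

(** The endomorphism ring of X is local: after normalizing u to the identity, if
    f2 is not bijective then it is nilpotent, and f1 = 1 - f2 is injective. *)
Lemma bij_add (f1 f2 u : {linear X -> X}) : bijective u ->
  (forall x, u x = f1 x + f2 x) -> bijective f1 \/ bijective f2.
Proof.
move=> uB uE; have [v [uK vK]] := bij_inverse uB.
have [|f2N] := EM (bijective f2); [by right | left].
(* v is the inverse of u, and 1 - v f2 = v f1. *)
have pN : ~ bijective (v \o f2).
  move=> pB; apply: f2N; apply: (eq_bij (bij_comp uB pB)) => x /=.
  by rewrite vK.
have [m pm] := nonauto_nilpotent pN.
apply: endo_inj_bij; apply: lin_inj => x fx.
have px : (v \o f2) x = x by rewrite /= -[f2 x]add0r -fx -uE uK.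
by rewrite -(pm x); elim: m {pm} => //= m <-.
Qed.

End Indecomposable.

Lemma indecomposable_iso M N : isomorphic M N -> indecomposable M -> indecomposable N.
Proof.
move=> MN [M0 Mi]; split=> [N0|K L NKL]; last by apply: Mi; apply: iso_trans NKL.
case: MN => f fB; apply: M0; exact: is_zero_inj (bij_inj fB) N0.
Qed.

Lemma retract_len N M : retract N M -> fl M -> fl N.
Proof. by case=> i [r /can_inj iI]; apply: finite_length_inj iI. Qed.

(** * Decomposition into indecomposables *)

Section DirectSums.
Variable D : lmodType B -> Prop.

Lemma direct_sum_iso k M N :
  isomorphic M N -> is_direct_sum_of D k M -> is_direct_sum_of D k N.
Proof.
case: k => [|k] /= MN; first by case: MN => f fB; exact: is_zero_epi (bij_epi fB).
case=> A [L [DA DL ML]]; exists A, L; split=> //.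
exact: iso_trans (iso_sym MN) ML.
Qed.

(** Reassociate the product at each summand of the first sum. *)
Lemma direct_sum_prod k l M N :
  is_direct_sum_of D k M -> is_direct_sum_of D l N ->
  is_direct_sum_of D (k + l) (M * N)%type.
Proof.
elim: k M => [|k IH] M /= DM DN.
  apply: direct_sum_iso DN; exists (in2 M N); apply: inj_epi_bij => [x y []//|[a b]].
  by exists b; congr pair; rewrite (DM a).
have [A [L [DA DL [f fB]]]] := DM; exists A, (L * N)%type; split=> //; first exact: IH.
have [g [fK gK]] := bij_inverse fB.
exists (pairing (pr1 A L \o f \o pr1 M N)
  (pairing (pr2 A L \o f \o pr1 M N) (pr2 M N))).
apply: inj_epi_bij => [|[a [b c]]].
  apply: lin_inj => -[x y] /= [f1 f2 ->].
  by congr pair; apply: (bij_inj fB); rewrite linear0 [f x]surjective_pairing f1 f2.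
by exists (g (a, b), c); rewrite /= gK.
Qed.

End DirectSums.

(** Induction on the length, splitting a decomposable module in two shorter ones. *)
Lemma indecomposable_sum (D : lmodType B -> Prop) M :
  (forall N L, D N -> retract L N -> D L) -> fl M -> D M ->
  exists k, is_direct_sum_of (fun N => D N /\ indecomposable N) k M.
Proof.
move=> Dr; have [k] := ubnP (len M); elim: k M => // k IH M lenM FM DM.
have [M0|M0] := EM (is_zero M); first by exists 0%N.
have [Mi|] := EM (indecomposable M).
  exists 1%N; exists M, (Ker (@idfun M : {linear M -> M})); split=> //=.
    by move=> x; apply: ker_incl_inj; rewrite linear0; exact: ker_incl0 x.
  exact: (retract_split (i := idfun) (r := idfun)).
move=> Mni; have [N [L [iso N0 L0]]] : exists N L,
    [/\ isomorphic M (N * L)%type, ~ is_zero N & ~ is_zero L].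
  apply: contrapT => no; apply: Mni; split=> // N L iso.
  have [|N0] := EM (is_zero N); first by left.
  by right; apply: contrapT => L0; case: no; exists N, L.
have [f fB] := iso; have [g [fK gK]] := bij_inverse fB.
have rN : retract N M by apply/summand_retract; exists L.
have rL : retract L M.
  by exists (g \o in2 N L), (pr2 N L \o f) => x /=; rewrite gK.
have [FN FL] := (retract_len rN FM, retract_len rL FM).
have s : ses (g \o in1 N L) (pr2 N L \o f).
  split.
  - by move=> x y /= /(bij_inj (Bijective gK fK)) [].
  - by move=> y; exists (g (0, y)); rewrite /= gK.
  - move=> x /=; split=> [fx2|[y <-]]; last by rewrite gK.
    by exists (f x).1; rewrite -[RHS]fK [f x in RHS]surjective_pairing fx2.
have E : len M = (len N + len L)%N := len_ses Ssimple s FM.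
have Np : (0 < len N)%N by rewrite lt0n; apply/negP => /(len0 FN).
have Lp : (0 < len L)%N by rewrite lt0n; apply/negP => /(len0 FL).
have [] := IH N _ FN (Dr _ _ DM rN); first by move: lenM Lp; rewrite E; clear; lia.
move=> a Na; have [] := IH L _ FL (Dr _ _ DM rL).
  by move: lenM Np; rewrite E; clear; lia.
move=> b Lb; exists (a + b)%N.
by apply: direct_sum_iso (direct_sum_prod Na Lb); exact: iso_sym.
Qed.

End Endomorphisms.

(** * Modules filtered by standard modules *)

Section Layers.
Variables (B : pzRingType) (n : nat) (S P Delta : 'I_n -> lmodType B).
Variables (top : forall i, {linear P i -> S i}).
Variables (pi : forall i, {linear P i -> Delta i}).
Hypothesis Ssimple : forall i, is_simple (S i).
Hypothesis Sdistinct : forall i j, isomorphic (S i) (S j) -> i = j.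
Hypothesis Pcover : forall i, is_projective_cover (top i).
Hypothesis Delta_largest : forall i, is_largest_factor_le S i (pi i).
Implicit Types M N L K Q U T E : lmodType B.

Definition factors_below (k : nat) M :=
  exists w, has_filtration S w M /\ all (fun j : 'I_n => (j < k)%N) w.

Lemma factors_below_sub k U M Q (u : {linear U -> M}) (q : {linear M -> Q}) :
  ses u q -> factors_below k M -> factors_below k U.
Proof.
move=> s [w [Fw wk]].
have [w1 [w2 [F1 F2 /perm_all E]]] := has_filtration_ses Ssimple s Fw.
by exists w1; split=> //; move: wk; rewrite -E all_cat => /andP[].
Qed.

Lemma factors_below_quot k U M Q (u : {linear U -> M}) (q : {linear M -> Q}) :
  ses u q -> factors_below k M -> factors_below k Q.
Proof.
move=> s [w [Fw wk]].
have [w1 [w2 [F1 F2 /perm_all E]]] := has_filtration_ses Ssimple s Fw.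
by exists w2; split=> //; move: wk; rewrite -E all_cat => /andP[].
Qed.

Lemma factors_below_ext k U M Q (u : {linear U -> M}) (q : {linear M -> Q}) :
  ses u q -> factors_below k U -> factors_below k Q -> factors_below k M.
Proof.
move=> s [w1 [F1 k1]] [w2 [F2 k2]]; exists (w2 ++ w1).
by rewrite all_cat k1 k2; split=> //; exact: has_filtration_cat s F1 F2.
Qed.

Lemma factors_below_inj k M N (f : {linear M -> N}) :
  injective f -> factors_below k N -> factors_below k M.
Proof. by move=> fI; apply: factors_below_sub (ses_coker fI). Qed.

Lemma factors_below_epi k M N (f : {linear M -> N}) :
  is_epi f -> factors_below k M -> factors_below k N.
Proof. by move=> fE; apply: factors_below_quot (ses_ker fE). Qed.

Lemma factors_below_le k l M : (k <= l)%N -> factors_below k M -> factors_below l M.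
Proof.
move=> kl [w [Fw wk]]; exists w; split=> //; apply: sub_all wk => j jk.
exact: leq_trans kl.
Qed.

Lemma factors_below_fl k M : factors_below k M -> finite_length S M.
Proof. by case=> w []; exists w. Qed.

Lemma factors_below_zero k M : is_zero M -> factors_below k M.
Proof. by move=> M0; exists [::]. Qed.

Lemma factors_below_simple (i : 'I_n) : factors_below i.+1 (S i).
Proof.
exists [:: i]; rewrite /= ltnSn; split=> //.
exists (Ker (@idfun (S i) : {linear S i -> S i})), (ker_incl idfun), idfun; split.
- exact: ker_incl_inj.
- by move=> y; exists y.
- exact: ker_inclP.
- by move=> x; apply: ker_incl_inj; rewrite linear0; exact: ker_incl0 x.
Qed.

Definition relatively_projective (k : nat) T :=
  forall E L (g : {linear E -> L}) (f : {linear T -> L}),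
    factors_below k E -> is_epi g -> exists h : {linear T -> E}, forall x, g (h x) = f x.

(** The image of h is a factor module of P(i) of the kind of which Delta(i) is the
    largest. *)
Lemma pi_kernel (i : 'I_n) E (h : {linear P i -> E}) :
  factors_below i.+1 E -> forall x, pi i x = 0 -> h x = 0.
Proof.
move=> FE x px; have [_ _ Dmax] := Delta_largest i.
have [e [eE eP]] := im_factor h.
rewrite -eP (Dmax _ e eE _ x px) ?linear0 //.
by apply: factors_below_inj FE; exact: im_incl_inj.
Qed.

Lemma Delta_factors (i : 'I_n) : factors_below i.+1 (Delta i).
Proof. by have [_] := Delta_largest i. Qed.

(** Lift through P(i); by [pi_kernel] the lift factors through Delta(i). *)
Lemma Delta_relatively_projective (i : 'I_n) : relatively_projective i.+1 (Delta i).
Proof.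
move=> E L g f FE gE; have [piE _ _] := Delta_largest i.
have [_ Pproj _ _] := Pcover i.
have [h hP] := Pproj _ _ g (f \o pi i) gE.
have [h' h'P] := factor_epi piE (pi_kernel h FE).
by exists h' => y; have [x <-] := piE y; rewrite h'P hP.
Qed.

(** Delta(i) inherits from the projective cover P(i) an essential epimorphism to
    S(i). *)
Lemma Delta_top i : exists s : {linear Delta i -> S i},
  is_epi s /\ forall N (f : {linear N -> Delta i}), is_epi (s \o f) -> is_epi f.
Proof.
have [piE _ _] := Delta_largest i.
have [_ _ topE topess] := Pcover i.
have [s sP] := factor_epi piE (pi_kernel (top i) (factors_below_simple i)).
exists s; split=> [y|N f sfE].
  by have [x <-] := topE y; exists (pi i x); rewrite sP.
pose L := Ker (coker_proj f \o pi i).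
pose l := ker_incl (coker_proj f \o pi i).
have lE : is_epi l.
  apply: topess => y; have [a <-] := sfE y; have [x xP] := piE (f a).
  have [|z zP] := (@ker_inclP _ _ _ (coker_proj f \o pi i) x).1.
    by rewrite /= xP; apply/coker_projP; exists a.
  by exists z; rewrite /= /l zP -sP xP.
move=> y; have [x <-] := piE y; have [z <-] := lE x.
by apply/coker_projP; exact: (@ker_incl0 _ _ _ (coker_proj f \o pi i) z).
Qed.

(** Up to isomorphism these are the direct sums of copies of Delta(i), with i = k.
    The intrinsic form is what makes closure under retracts evident. *)
Definition top_layer k T :=
  [/\ factors_below k.+1 T, relatively_projective k.+1 T
    & forall Q (q : {linear T -> Q}), is_epi q -> factors_below k Q -> is_zero Q].

Lemma top_layer_retract k T T' : retract T' T -> top_layer k T -> top_layer k T'.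
Proof.
move=> [i [r iK]] [Tk Tproj Tq]; split.
- by apply: factors_below_inj Tk; exact: can_inj iK.
- move=> E L g f FE gE; have [h hP] := Tproj _ _ g (f \o r) FE gE.
  by exists (h \o i) => x; rewrite /= hP /= iK.
- move=> Q q qE; apply: (Tq Q (q \o r)) => y.
  by have [x <-] := qE y; exists (i x); rewrite /= iK.
Qed.

Lemma simple_factor_eq (i j : 'I_n) (g : {linear S i -> S j}) : is_epi g -> i = j.
Proof.
move=> gE; apply: Sdistinct; exists g; apply: inj_epi_bij => //.
have [S0 Ssub] := Ssimple i.
have [gK|gK] := Ssub _ (GRing.submodClosedP (ker_pred g)).
  by apply: lin_inj => x /eqP gx; exact: gK.
have [Sj0 _] := Ssimple j; case: Sj0 => y; have [x <-] := gE y.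
exact/eqP/gK.
Qed.

Lemma simple_not_below (i : 'I_n) k : (k <= i)%N -> ~ factors_below k (S i).
Proof.
move=> ki [[|j w] [/= Fw jk]]; first by have [] := Ssimple i.
have [M' [f [g [_ gE _ _]]]] := Fw.
by move: jk; rewrite -(simple_factor_eq gE) ltnNge ki.
Qed.

(** If the kernel of a quotient map from Delta(i) does not map onto S(i), then S(i)
    is a factor of the quotient; otherwise the kernel is everything, as the
    epimorphism to S(i) is essential. *)
Lemma top_layer_Delta (i : 'I_n) : top_layer i (Delta i).
Proof.
split; [exact: Delta_factors | exact: Delta_relatively_projective |].
move=> Q q qE FQ; have [s [sE sess]] := Delta_top i.
have [s0|sK] := simple_image (s \o ker_incl q) (Ssimple i); last first.
  move=> y; have [x <-] := qE y; have [z <-] := sess _ _ sK x.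
  exact: ker_incl0.
have [|t tP] := factor_epi (h := s) qE.
  by move=> x /ker_inclP[y <-]; exact: s0.
case: (@simple_not_below i i (leqnn i)); apply: (factors_below_epi (f := t)) FQ.
by move=> y; have [x <-] := sE y; exists (q x); rewrite tP.
Qed.

Lemma top_layer_prod k T T' :
  top_layer k T -> top_layer k T' -> top_layer k (T * T')%type.
Proof.
move=> [Fk Tp Tq] [Fk' Tp' Tq']; split.
- apply: (factors_below_ext (u := in1 T T') (q := pr2 T T')) => //; split.
  + by move=> x y [].
  + by move=> y; exists (0, y).
  + by move=> [x y] /=; split=> [->|[z [_ <-]]//]; exists x.
- move=> E L g f FE gE.
  have [h1 h1P] := Tp _ _ g (f \o in1 T T') FE gE.
  have [h2 h2P] := Tp' _ _ g (f \o in2 T T') FE gE.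
  exists (copairing h1 h2) => -[x y] /=; rewrite linearD h1P h2P /= -linearD.
  by congr (f _); congr pair; rewrite ?addr0 ?add0r.
- move=> Q q qE FQ.
  have z1 x : q (x, 0) = 0.
    have [e [eE eP]] := im_factor (q \o in1 T T').
    rewrite -[LHS]eP (Tq _ e eE _ (e x)) ?linear0 //.
    by apply: factors_below_inj FQ; exact: im_incl_inj.
  have z2 x : q (0, x) = 0.
    have [e [eE eP]] := im_factor (q \o in2 T T').
    rewrite -[LHS]eP (Tq' _ e eE _ (e x)) ?linear0 //.
    by apply: factors_below_inj FQ; exact: im_incl_inj.
  move=> y; have [[a b] <-] := qE y.
  rewrite (_ : (a, b) = (a, 0) + (0, b)) ?linearD ?z1 ?z2 ?addr0 //.
  by congr pair; rewrite ?addr0 ?add0r.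
Qed.

(** The trace filtration of a Delta-filtered module: the bottom step is built from
    the standard module of largest index. *)
Fixpoint layered (k : nat) M : Prop :=
  if k is k'.+1 then
    exists U Q (u : {linear U -> M}) (q : {linear M -> Q}),
      [/\ ses u q, top_layer k' U & layered k' Q]
  else is_zero M.

Lemma layered_factors k M : layered k M -> factors_below k M.
Proof.
elim: k M => [|k IH] M /=; first exact: factors_below_zero.
case=> U [Q [u [q [s [Uk _ _] /IH Qk]]]].
exact: factors_below_ext s Uk (factors_below_le (leqnSn k) Qk).
Qed.

(** The submodule U has no nonzero map to M / U, so it is stable under the
    idempotent of M defined by N.  Hence U and M / U induce an exact sequence on
    N whose ends are retracts of U and M / U. *)
Lemma layered_retract k N M : retract N M -> layered k M -> layered k N.
Proof.
elim: k N M => [|k IH] N M [i [r iK]] /=; first exact/is_zero_inj/can_inj/iK.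
case=> U [Q [u [q [s Ut Ql]]]]; have [uI qE uqE] := s.
have Qk := layered_factors Ql.
(* The composite from U to Q has an image that is a quotient of the top layer
   U with only smaller composition factors. *)
have u0 x : q (i (r (u x))) = 0.
  have [e [eE eP]] := im_factor (q \o i \o r \o u).
  have [_ _ Uq] := Ut.
  rewrite -[LHS]eP (Uq _ e eE _ (e x)) ?linear0 //.
  by apply: factors_below_inj Qk; exact: im_incl_inj.
have [e [eE eP]] := im_factor (q \o i).
exists (Ker (q \o i)), (Im (q \o i)), (ker_incl (q \o i)), e; split.
- split=> //; first exact: ker_incl_inj.
  move=> x; rewrite -ker_inclP -eP; split=> [->|e0]; first by rewrite linear0.
  by apply: im_incl_inj; rewrite e0 linear0.
- have [|j jP] := factor_mono (h := i \o ker_incl (q \o i)) uI.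
    by move=> x; apply/uqE; exact: (@ker_incl0 _ _ _ (q \o i)).
  have [|t tP] := factor_mono (h := r \o u) (@ker_incl_inj _ _ _ (q \o i)).
    by move=> x; apply/(@ker_inclP _ _ _ (q \o i)); exact: u0.
  apply: top_layer_retract Ut; exists j, t => x.
  by apply: ker_incl_inj; rewrite tP /= jP /= iK.
- apply: IH Ql; have [|t tP] := factor_epi (h := e \o r) qE.
    by move=> x /uqE[y <-]; apply: im_incl_inj; rewrite eP /= u0 linear0.
  exists (im_incl (q \o i)), t => z; have [x <-] := eE z.
  by rewrite eP tP /= iK.
Qed.

Lemma layered_zero k M : is_zero M -> layered k M.
Proof.
elim: k M => [//|k IH] M M0 /=.
exists M, M, idfun, idfun; split; last exact: IH.
  by split=> // [y|x]; [exists y | split=> [_|_]; [exists x|exact: M0]].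
split=> [|E L g f FE gE|Q q qE _]; first exact: factors_below_zero.
  by exists \0 => x; rewrite (M0 x) !linear0.
exact: is_zero_epi qE M0.
Qed.

(** A standard module put on top of a layered module sinks to its layer.  If j is
    the largest index, then Delta(j) splits off by relative projectivity and
    joins the bottom layer; otherwise pass to the quotient by the bottom
    layer. *)
Lemma layered_ext k (j : 'I_n) M' M (u : {linear M' -> M}) (g : {linear M -> Delta j}) :
  (j < k)%N -> ses u g -> layered k M' -> layered k M.
Proof.
elim: k M' M u g => [//|k IH] M' M u g jk [uI gE ugE].
case=> U' [Q' [u' [q' [[uI' qE' uqE'] Ut' Ql']]]].
have Mk : layered k.+1 M' by exists U', Q', u', q'.
have M'k := layered_factors Mk; have Q'k := layered_factors Ql'.
move: jk; rewrite ltnS leq_eqVlt => /orP[/eqP jk|jk].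
  have FM : factors_below j.+1 M.
    apply: (factors_below_ext (u := u) (q := g)) => //; last exact: Delta_factors.
    by rewrite jk.
  have [s sP] := Delta_relatively_projective idfun FM gE.
  have [|p pP] := factor_mono (h := idfun \- (s \o g)) uI.
    by move=> x; apply/ugE; rewrite /= linearB sP subrr.
  have gu x : g (u x) = 0 by apply/ugE; exists x.
  have pu x : p (u x) = x.
    by apply: uI; rewrite pP /= gu linear0 subr0.
  have ps x : p (s x) = 0 by apply: uI; rewrite pP /= sP subrr linear0.
  exists (U' * Delta j)%type, Q', (copairing (u \o u') s), (q' \o p); split=> //.
    split.
    + apply: lin_inj => -[a b] /= ab.
      have b0 : b = 0 by have := congr1 g ab; rewrite linearD gu sP add0r linear0.
      move: ab; rewrite b0 linear0 addr0 => ab.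
      by congr pair; apply/uI'/uI; rewrite ab !linear0.
    + by move=> y; have [x <-] := qE' y; exists (u x); rewrite /= pu.
    + move=> x; split=> [/uqE'[y yP]|[[a b] <-]] /=; last first.
        by rewrite linearD pu ps addr0; apply/uqE'; exists a.
      by exists (y, g x); rewrite /= yP pP /= subrK.
  by apply: top_layer_prod => //; rewrite -jk; exact: top_layer_Delta.
pose q := coker_proj (u \o u').
have qE : is_epi q by exact: coker_proj_epi.
have qP x : q x = 0 <-> exists y, u (u' y) = x := @coker_projP _ _ _ (u \o u') x.
have [|t tP] := factor_epi (h := q \o u) qE'.
  by move=> x /uqE'[y <-]; apply/qP; exists y.
have [|g' g'P] := factor_epi (h := g) qE.
  by move=> x /qP[y <-]; apply/ugE; exists (u' y).
exists U', (Coker (u \o u')), (u \o u'), q; split=> //.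
  by split=> //; exact: inj_comp.
apply: (IH Q' _ t g') => //; split.
- apply: lin_inj => y; have [x <-] := qE' y; rewrite tP => /qP[z /uI <-].
  by apply/uqE'; exists z.
- by move=> y; have [x <-] := gE y; exists (q x); rewrite g'P.
- move=> y; split=> [|[z <-]].
    have [x <-] := qE y; rewrite g'P => /ugE[z <-].
    by exists (q' z); rewrite tP.
  by have [x <-] := qE' z; rewrite tP /= g'P; apply/ugE; exists x.
Qed.

Lemma filtered_layered M : filtered Delta M -> layered n M.
Proof.
case=> w; elim: w M => [|i w IH] M /=; first exact: layered_zero.
by case=> M' [f [g [fI gE fgE /IH]]]; apply: (layered_ext (u := f) (g := g)).
Qed.

(** A nonzero top layer T maps onto S(i), since its factors S(j) with j < i do not
    occur as quotients.  By relative projectivity this lifts to a map from T to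
    Delta(i), surjective since the kernel of Delta(i) -> S(i) is superfluous, and
    split since Delta(i) is relatively projective.  The kernel is a shorter top
    layer. *)
Lemma top_layer_filtered (i : 'I_n) T : top_layer i T -> filtered Delta T.
Proof.
have [l] := ubnP (len S T); elim: l T => // l IH T lT Tt.
have [T0|T0] := EM (is_zero T); first by exists [::].
have [[[|j w] [Fw wk]] Tp Tq] := Tt; first by [].
move: Fw wk => /= [M' [_ [g [_ gE _ _]]]] /andP[ji _].
(* The first factor of a composition series of T is a quotient of T, hence S(i). *)
have ij : j = i.
  apply/val_inj/eqP; rewrite eqn_leq -ltnS ji leqNgt; apply/negP => ji'.
  have [Sj _] := Ssimple j; apply: Sj; apply: (Tq _ g gE).
  exact: factors_below_le (factors_below_simple j).
move: g gE; rewrite {M'}ij => g gE.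
have [s [sE sess]] := Delta_top i.
have [f fP] := Tp _ _ s g (Delta_factors i) sE.
have fE : is_epi f.
  by apply: sess => y; have [x <-] := gE y; exists x; rewrite /= fP.
have [Tk _ _] := Tt.
have [t tP] := Delta_relatively_projective idfun Tk fE.
have fs := ses_ker fE.
have [|p pP] := factor_mono (h := idfun \- (t \o f)) (@ker_incl_inj _ _ _ f).
  by move=> x; apply/ker_inclP; rewrite /= linearB tP subrr.
have rK : retract (Ker f) T.
  exists (ker_incl f), p => x; apply: ker_incl_inj.
  by rewrite pP /= ker_incl0 linear0 subr0.
have FT := factors_below_fl Tk.
have [w' Fw'] : filtered Delta (Ker f).
  apply: IH (top_layer_retract rK Tt); rewrite -ltnS (leq_trans _ lT) // ltnS.
  rewrite (len_ses Ssimple fs FT) -{1}[len S (Ker f)]addn0 ltn_add2l lt0n.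
  have FD := factors_below_fl (Delta_factors i).
  apply/negP => /(len0 FD) D0; case: (Ssimple i) => Si0 _; apply: Si0.
  exact: is_zero_epi sE D0.
exists (i :: w'), (Ker f), (ker_incl f), f.
by case: fs.
Qed.

Lemma filtered_ext U M Q (u : {linear U -> M}) (q : {linear M -> Q}) :
  ses u q -> filtered Delta U -> filtered Delta Q -> filtered Delta M.
Proof.
by move=> s [w1 F1] [w2 F2]; exists (w2 ++ w1); exact: has_filtration_cat s F1 F2.
Qed.

Lemma layered_filtered k M : (k <= n)%N -> layered k M -> filtered Delta M.
Proof.
elim: k M => [|k IH] M kn /=; first by exists [::].
case=> U [Q [u [q [s Ut Ql]]]]; apply: filtered_ext s _ (IH _ (ltnW kn) Ql).
exact: (top_layer_filtered (i := Ordinal kn)).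
Qed.

Theorem filtered_retract N M : retract N M -> filtered Delta M -> filtered Delta N.
Proof.
by move=> r /filtered_layered/(layered_retract r); exact: layered_filtered.
Qed.

Lemma filtered_fl M : filtered Delta M -> finite_length S M.
Proof. by move=> /filtered_layered/layered_factors/factors_below_fl. Qed.

(** A free module of rank k, built up as a product so that it is visibly filtered. *)
Lemma filtered_generate M k (v : 'I_k -> M) : filtered Delta B^o ->
  exists L (f : {linear L -> M}), filtered Delta L /\
    forall c : 'I_k -> B, exists x, f x = \sum_(j < k) c j *: v j.
Proof.
move=> FB; elim: k v => [|k IH] v.
  by exists B^o, \0; split=> // c; exists 0; rewrite big_ord0.
have [L [f [FL fP]]] := IH (v \o lift ord0).
have lv : linear ((fun a => (a : B) *: (v ord0 : M)) : B^o -> M).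
  by move=> a x y; rewrite scalerDl scalerA.
exists (B^o * L)%type, (copairing (lin lv) f); split.
  apply: (filtered_ext (u := in1 B^o L) (q := pr2 B^o L)) => //; split.
  + by move=> x y [].
  + by move=> y; exists (0, y).
  + by move=> [x y] /=; split=> [->|[z [_ <-]]//]; exists x.
move=> c; have [x xP] := fP (c \o lift ord0).
by exists (c ord0, x); rewrite /= xP big_ord_recl.
Qed.

Lemma filtered_projective M : filtered Delta B^o ->
  finitely_generated M -> is_projective M -> filtered Delta M.
Proof.
move=> FB [k [v vP]] Mp; have [L [f [FL fP]]] := filtered_generate v FB.
have fE : is_epi f.
  by move=> y; have [c ->] := vP y; exact: fP.
have [s sP] := Mp _ _ f idfun fE.
by apply: filtered_retract FL; exists s, f.
Qed.

End Layers.

(** * Generation by splitting projectives *)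

Section Generation.
Variables (B : pzRingType) (n : nat) (S : 'I_n -> lmodType B).
Hypothesis Ssimple : forall i, is_simple (S i).
Implicit Types M N L K X Y : lmodType B.
Implicit Types D E : lmodType B -> Prop.

Local Notation fl := (finite_length S).
Local Notation len := (len S).

Definition generated D M :=
  exists k L (f : {linear L -> M}), is_direct_sum_of D k L /\ is_epi f.

Lemma generated_epi D M N (f : {linear M -> N}) :
  is_epi f -> generated D M -> generated D N.
Proof.
move=> fE [k [L [g [DL gE]]]]; exists k, L, (f \o g); split=> // y.
by have [x <-] := fE y; have [z <-] := gE x; exists z.
Qed.

Lemma generated_prod D M N :
  generated D M -> generated D N -> generated D (M * N)%type.
Proof.
move=> [k [L [f [DL fE]]]] [l [K [g [DK gE]]]].
exists (k + l)%N, (L * K)%type, (pairing (f \o pr1 L K) (g \o pr2 L K)).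
split=> [|[a b]]; first exact: direct_sum_prod.
by have [x <-] := fE a; have [y <-] := gE b; exists (x, y).
Qed.

Lemma generated_self D M : D M -> generated D M.
Proof.
move=> DM; exists 1%N, (M * Ker (@idfun M : {linear M -> M}))%type, (pr1 _ _).
split=> [|y]; last by exists (y, 0).
exists M, (Ker (@idfun M : {linear M -> M})); split=> //=; last exact: iso_refl.
by move=> x; apply: ker_incl_inj; rewrite linear0; exact: ker_incl0 x.
Qed.

Lemma generated_sum D E k L : (forall N, D N -> generated E N) ->
  is_direct_sum_of D k L -> generated E L.
Proof.
move=> DE; elim: k L => [|k IH] L /=.
  by move=> L0; exists 0%N, L, idfun; split=> // y; exists y.
case=> N [L' [/DE EN /IH EL' /iso_sym[f fB]]].
exact: generated_epi (bij_epi fB) (generated_prod EN EL').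
Qed.

Lemma generated_trans D E M : (forall N, D N -> generated E N) ->
  generated D M -> generated E M.
Proof.
by move=> DE [k [L [f [DL fE]]]]; apply: generated_epi fE (generated_sum DE DL).
Qed.

Definition in_trace D X (x : X) :=
  exists k L (g : {linear L -> X}), is_direct_sum_of D k L /\ exists z, g z = x.

(** Choose finitely many maps step by step: as long as their sum g is not onto,
    a point outside its image provides a map that increases the length of the
    image. *)
Lemma trace_generated D X : fl X -> (forall x, @in_trace D X x) -> generated D X.
Proof.
move=> FX Tx.
suff IH l k L (g : {linear L -> X}) : (len X < len (Im g) + l)%N ->
    is_direct_sum_of D k L -> generated D X.
  have [k [L [g [DL _]]]] := Tx 0.
  by apply: (IH (len X).+1 _ _ g _ DL); rewrite addnS ltnS leq_addl.
elim: l k L g => [|l IH] k L g lt DL.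
  by move: lt; rewrite addn0 ltnNge (len_inj Ssimple (@im_incl_inj _ _ _ g) FX).
have [gE|gE] := EM (is_epi g); first by exists k, L, g.
have [x xP] : exists x, forall z, g z <> x.
  apply: contrapT => no; apply: gE => x; apply: contrapT => nx.
  by apply: no; exists x => z zx; apply: nx; exists z.
have [k' [L' [g' [DL' [z zx]]]]] := Tx x.
have fact t : g t = copairing g g' (in1 L L' t) by rewrite /= linear0 addr0.
apply: (IH (k + k')%N _ (copairing g g')); last exact: direct_sum_prod.
rewrite (leq_trans lt) // addnS -addSn leq_add2r ltnNge; apply/negP => le.
(* Without an increase in length, the two images would agree. *)
have [t tP] := rank_comp_l_eq Ssimple fact (0, z) FX le.
by apply: (xP t); rewrite -tP /= linear0 add0r.
Qed.

Section Nakayama.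
Variables (D : lmodType B -> Prop) (X : lmodType B).
Hypotheses (Xi : indecomposable X) (FX : fl X).

(** The submodule of X generated by the trace of D and by the images of the
    composites of m nonautomorphisms of X. *)
Inductive radical_layer (m : nat) : X -> Prop :=
| Layer0 : radical_layer m 0
| LayerT x : in_trace D x -> radical_layer m x
| LayerW (f : {linear X -> X}) x : nonauto_word m f -> radical_layer m (f x)
| LayerD x y : radical_layer m x -> radical_layer m y -> radical_layer m (x + y).

Lemma trace_add x y : @in_trace D X x -> @in_trace D X y -> @in_trace D X (x + y).
Proof.
move=> [k [L [f [DL [a <-]]]]] [l [K [g [DK [b <-]]]]].
exists (k + l)%N, (L * K)%type, (copairing f g); split; first exact: direct_sum_prod.
by exists (a, b).
Qed.

Lemma trace_map (f : {linear X -> X}) x : @in_trace D X x -> @in_trace D X (f x).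
Proof.
move=> [k [L [g [DL [a <-]]]]]; exists k, L, (f \o g); split=> //.
by exists a.
Qed.

Lemma trace0 : @in_trace D X 0.
Proof.
pose Z := Ker (@idfun X : {linear X -> X}).
exists 0%N, Z, \0; split; last by exists 0.
by move=> x; apply: ker_incl_inj; rewrite linear0; exact: ker_incl0 x.
Qed.

Lemma radical_layerS m : (forall x, radical_layer 1 x) ->
  (forall x, radical_layer m x) -> forall x, radical_layer m.+1 x.
Proof.
move=> G1 Gm x; elim: (Gm x) => {x} [|x Tx|f x fw|x y _ Gx _ Gy].
- exact: Layer0.
- exact: LayerT.
- elim: (G1 x) => {x} [|x Tx|g x gw|x y _ Gx _ Gy].
  + by rewrite linear0; exact: Layer0.
  + by apply: LayerT; exact: trace_map.
  + apply: (LayerW (f := f \o g)); rewrite -addn1; exact: nonauto_word_cat.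
  + by rewrite linearD; exact: LayerD.
- exact: LayerD.
Qed.

Lemma radical_layer_sum k L (h : {linear L -> X}) :
  is_direct_sum_of (fun N => D N \/ isomorphic N X) k L ->
  ~ (exists s : {linear X -> L}, cancel s h) -> forall x, radical_layer 1 (h x).
Proof.
elim: k L h => [|k IH] L h /=.
  by move=> L0 _ x; rewrite (L0 x) linear0; exact: Layer0.
case=> N [L' [DN DL' [f /bij_inverse[g [fK gK]]]]] hN x.
have hE : h x = (h \o g \o in1 N L') (f x).1 + (h \o g \o in2 N L') (f x).2.
  rewrite /= -!linearD -[in LHS](fK x); congr (h (g _)).
  by rewrite [f x in LHS]surjective_pairing; congr pair; rewrite ?addr0 ?add0r.
rewrite hE; apply: LayerD; last first.
  apply: IH => // -[s sK]; apply: hN; exists (g \o in2 N L' \o s) => y.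
  exact: sK.
case: DN => [DN|[j jB]].
  have [l [K [e [DK eE]]]] := generated_self DN.
  apply: LayerT; exists l, K, (h \o g \o in1 N L' \o e); split=> //.
  by have [z <-] := eE (f x).1; exists z.
have [t [jK tK]] := bij_inverse jB.
rewrite -[(f x).1]jK; apply: (LayerW (f := h \o g \o in1 N L' \o t)).
exists (h \o g \o in1 N L' \o t), idfun; split=> // /bij_inverse[q [_ qK]].
by apply: hN; exists (g \o in1 N L' \o t \o q) => y; exact: qK.
Qed.

(** A component of h on a summand isomorphic to X is not bijective, as h does not
    split, so X = [radical_layer] 1.  Substituting this equation in itself gives
    X = [radical_layer] m for all m, and for large m only the trace of D is
    left. *)
Lemma nakayama k L (h : {linear L -> X}) :
  is_direct_sum_of (fun N => D N \/ isomorphic N X) k L ->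
  is_epi h -> ~ (exists s : {linear X -> L}, cancel s h) -> generated D X.
Proof.
move=> DL hE hN; have G1 x : radical_layer 1 x.
  by have [y <-] := hE x; exact: radical_layer_sum DL hN y.
have Gm m x : radical_layer m x.
  elim: m x => [|m IH]; last exact: radical_layerS.
  by move=> x; exact: (@LayerW 0 idfun).
have [m m0] := nonauto_word_zero Ssimple Xi FX.
apply: trace_generated => // x; elim: (Gm m x) => {x} [|//|f x fw|x y _ Tx _ Ty].
- exact: trace0.
- by rewrite m0 //; exact: trace0.
- exact: trace_add.
Qed.
End Nakayama.

Lemma direct_sum_sub D E k L : (forall N, D N -> E N) ->
  is_direct_sum_of D k L -> is_direct_sum_of E k L.
Proof.
move=> DE; elim: k L => //= k IH L [N [K [/DE EN /IH EK iso]]].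
by exists N, K.
Qed.

Section FiniteType.
Variables (D : lmodType B -> Prop) (r : nat) (X : 'I_r -> lmodType B).
Hypothesis D_fl : forall M, D M -> fl M.
Hypothesis D_retract : forall M N, D M -> retract N M -> D N.
Hypothesis D_finite : forall M, D M -> indecomposable M -> exists j, isomorphic M (X j).

(** The conditions on X j exclude the entries of the list that lie outside D. *)
Definition listed (I : {set 'I_r}) N :=
  exists j, [/\ j \in I, D (X j), indecomposable (X j) & isomorphic N (X j)].

Lemma listed_all M : D M -> generated (listed [set: 'I_r]%SET) M.
Proof.
move=> DM; have [k DS] := indecomposable_sum Ssimple D_retract (D_fl DM) DM.
exists k, M, idfun; split=> [|y]; last by exists y.
apply: direct_sum_sub DS => N [DN Ni]; have [j iso] := D_finite DN Ni.
exists j; split=> //; last exact: indecomposable_iso iso Ni.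
by apply: D_retract DN _; have [f fB] := iso_sym iso; exact: iso_retract fB.
Qed.

Lemma add_closure_generated E Y : (forall M, D M -> generated E M) ->
  add_closure D Y -> generated E Y.
Proof.
move=> DE [k [M [DM /summand_retract[i [s iK]]]]].
apply: (generated_epi (f := s)); first by move=> y; exists (i y); rewrite iK.
exact: generated_sum DM.
Qed.

(** Minimality of I is minimality of its cardinality.  If a member of I is not
    splitting projective, [nakayama] generates it by the rest of I, which then
    generates all of D. *)
Theorem splitting_projectives_generate M :
  D M -> generated (indec_splitting_projective D) M.
Proof.
pose gens I := forall M, D M -> generated (listed I) M.
have ex : exists m, `[< exists2 I, gens I & #|I| = m >].
  exists #|[set: 'I_r]%SET|; apply/asboolP.
  by exists [set: 'I_r]%SET => //; exact: listed_all.
case: (ex_minnP ex) => m /asboolP[I gI Im] mmin.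
move=> DM; apply: generated_trans (gI M DM) => N [j [jI DX Xi iso]].
apply: generated_self; have Ni := indecomposable_iso (iso_sym iso) Xi.
have DN : D N.
  by apply: D_retract DX _; have [f fB] := iso; exact: iso_retract fB.
split=> //; split=> // Y f DY fE; apply: contrapT => nosec.
have [k [L [e [DL eE]]]] := add_closure_generated gI DY.
have NI : generated (listed (I :\ j)%SET) N.
  apply: (nakayama (k := k) (h := f \o e) Ni (D_fl DN)).
  - apply: direct_sum_sub DL => K [i [iI DXi Xii Ki]].
    have [ij|ij] := eqVneq i j.
      by right; apply: iso_trans Ki _; rewrite ij; exact: iso_sym.
    by left; exists i; rewrite !inE ij.
  - by move=> y; have [x <-] := fE y; have [z <-] := eE x; exists z.
  - by move=> [s sK]; apply: nosec; exists (e \o s) => y; exact: sK.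
suff gI' : gens (I :\ j)%SET.
  have := mmin #|(I :\ j)%SET| (asboolT (ex_intro2 _ _ _ gI' erefl)).
  by rewrite -Im (cardsD1 j I) jI ltnn.
move=> K DK; apply: generated_trans (gI K DK) => K' [i [iI DXi Xii Ki]].
have [ij|ij] := eqVneq i j; last first.
  by apply: generated_self; exists i; rewrite !inE ij.
have [g gB] : isomorphic N K'.
  by apply: iso_trans iso _; rewrite -ij; exact: iso_sym.
exact: generated_epi (bij_epi gB) NI.
Qed.

End FiniteType.
End Generation.

(** * Powers of the radical and depth *)

Section Radical.
Variables (B : pzRingType) (n : nat) (S : 'I_n -> lmodType B).
Hypothesis Ssimple : forall i, is_simple (S i).
Variable C : lmodType B -> Prop.
Hypothesis C_fl : forall M, C M -> finite_length S M.
Implicit Types M N L K X Y P : lmodType B.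

Lemma in_rad_ext M N (f f' : {linear M -> N}) : f =1 f' -> in_rad C f -> in_rad C f'.
Proof.
move=> ff' [CM CN fr]; split=> // X CX Xi g h hB; apply: (fr X CX Xi g h).
by apply: (eq_bij hB) => x /=; rewrite ff'.
Qed.

Lemma in_rad_post M N L (f : {linear M -> N}) (g : {linear N -> L}) :
  C L -> in_rad C f -> in_rad C (g \o f).
Proof.
move=> CL [CM CN fr]; split=> // X CX Xi a h; exact: (fr X CX Xi a (h \o g)).
Qed.

Lemma in_rad_pre M N L (f : {linear M -> N}) (g : {linear L -> M}) :
  C L -> in_rad C f -> in_rad C (f \o g).
Proof.
move=> CL [CM CN fr]; split=> // X CX Xi a h; exact: (fr X CX Xi (g \o a) h).
Qed.

Lemma in_rad_zero M N (f : {linear M -> N}) :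
  C M -> C N -> (forall x, f x = 0) -> in_rad C f.
Proof.
move=> CM CN f0; split=> // X CX [X0 _] g h hB; apply: X0 => x.
by apply: (bij_inj hB); rewrite /= !f0.
Qed.

(** Additivity of the radical is where local endomorphism rings are needed. *)
Lemma in_rad_add M N (f1 f2 f : {linear M -> N}) :
  (forall x, f x = f1 x + f2 x) -> in_rad C f1 -> in_rad C f2 -> in_rad C f.
Proof.
move=> fE [CM CN r1] [_ _ r2]; split=> // X CX Xi g h hB.
have [|/(r1 X CX Xi)|/(r2 X CX Xi)] // := bij_add Ssimple Xi (C_fl CX)
  (f1 := h \o f1 \o g) (f2 := h \o f2 \o g) (u := h \o f \o g) hB.
by move=> x; rewrite /= fE linearD.
Qed.

Lemma rad_composite_post m M N L (f : {linear M -> N}) (g : {linear N -> L}) :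
  C L -> is_rad_composite C m f -> is_rad_composite C m (g \o f).
Proof.
move=> CL; case: m => [//|m]; elim: m M f => [|m IH] M f; first exact: in_rad_post.
case=> K [a [h [ar hm fE]]]; exists K, a, (g \o h); split=> //; first exact: IH.
by move=> x; rewrite /= fE.
Qed.

Lemma rad_composite_rad m M N L (f : {linear M -> N}) (g : {linear N -> L}) :
  in_rad C g -> is_rad_composite C m f -> is_rad_composite C m.+1 (g \o f).
Proof.
move=> gr; case: m => [//|m]; elim: m M f => [|m IH] M f; first by exists N, f, g.
case=> K [a [h [ar hm fE]]]; exists K, a, (g \o h); split=> //; first exact: IH.
by move=> x; rewrite /= fE.
Qed.

Lemma rad_composite_drop m M N (f : {linear M -> N}) :
  is_rad_composite C m.+2 f -> is_rad_composite C m.+1 f.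
Proof.
elim: m M f => [|m IH] M f; case=> K [a [h [ar hm fE]]].
  have [_ CN _] := hm.
  by apply: (in_rad_ext (f := h \o a)) => [x|]; [rewrite fE | exact: in_rad_post].
by exists K, a, h; split=> //; exact: IH.
Qed.

Lemma rad_composite_le m l M N (f : {linear M -> N}) : (0 < l <= m)%N ->
  is_rad_composite C m f -> is_rad_composite C l f.
Proof.
case/andP=> l0 /subnKC <-; elim: (m - l)%N => [|k IH]; first by rewrite addn0.
rewrite addnS => fm; apply: IH.
by case: l l0 fm => // l _; exact: rad_composite_drop.
Qed.

Lemma in_rad_pow_le m l M N (f : {linear M -> N}) : (0 < l <= m)%N ->
  in_rad_pow C m f -> in_rad_pow C l f.
Proof.
move=> lm [k [c [cm fE]]]; exists k, c; split=> // j.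
exact: rad_composite_le lm (cm j).
Qed.

Lemma in_rad_pow_ext m M N (f f' : {linear M -> N}) : f =1 f' ->
  in_rad_pow C m f -> in_rad_pow C m f'.
Proof. by move=> ff' [k [c [cm fE]]]; exists k, c; split=> // x; rewrite -ff'. Qed.

Lemma in_rad_pow_zero m M N (f : {linear M -> N}) :
  (forall x, f x = 0) -> in_rad_pow C m f.
Proof.
move=> f0; exists 0%N, (fun _ => \0); split; first by case.
by move=> x; rewrite big_ord0 f0.
Qed.

Lemma in_rad_pow_add m M N (f1 f2 f : {linear M -> N}) :
  (forall x, f x = f1 x + f2 x) ->
  in_rad_pow C m f1 -> in_rad_pow C m f2 -> in_rad_pow C m f.
Proof.
move=> fE [k1 [c1 [cm1 f1E]]] [k2 [c2 [cm2 f2E]]].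
exists (k1 + k2)%N, (fun j => match split j with inl i => c1 i | inr i => c2 i end).
split=> [j|x]; first by case: (split j).
rewrite fE f1E f2E big_split_ord /=; congr (_ + _); apply: eq_bigr => i _.
  by rewrite -[lshift _ _]/(unsplit (inl i)) unsplitK.
by rewrite -[rshift _ _]/(unsplit (inr i)) unsplitK.
Qed.

Lemma in_rad_pow_post m M N L (f : {linear M -> N}) (g : {linear N -> L}) :
  C L -> in_rad_pow C m f -> in_rad_pow C m (g \o f).
Proof.
move=> CL [k [c [cm fE]]]; exists k, (fun j => g \o c j); split=> [j|x].
  exact: rad_composite_post.
by rewrite /= fE linear_sum.
Qed.

Lemma in_rad_pow_rad m M N L (f : {linear M -> N}) (g : {linear N -> L}) :
  in_rad C g -> in_rad_pow C m f -> in_rad_pow C m.+1 (g \o f).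
Proof.
move=> gr [k [c [cm fE]]]; exists k, (fun j => g \o c j); split=> [j|x].
  exact: rad_composite_rad.
by rewrite /= fE linear_sum.
Qed.

Lemma in_rad_pow1 M N (f : {linear M -> N}) : in_rad C f -> in_rad_pow C 1 f.
Proof.
by move=> fr; exists 1%N, (fun _ => f); split=> // x; rewrite big_ord1.
Qed.

Lemma in_rad_pow_in_rad m M N (f : {linear M -> N}) : (0 < m)%N ->
  C M -> C N -> in_rad_pow C m f -> in_rad C f.
Proof.
move=> m0 CM CN /(in_rad_pow_le (l := 1)) []; first by rewrite m0.
move=> k [c [cm fE]]; elim: k c cm f fE => [|k IH] c cm f fE.
  by apply: in_rad_zero => // x; rewrite fE big_ord0.
pose ls := fun x : M => \sum_(j < k) c (lift ord0 j) x.
have lls : linear ls.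
  move=> a x y; rewrite /ls scaler_sumr -big_split.
  by apply: eq_bigr => i _; rewrite linearP.
apply: (in_rad_add (f1 := c ord0) (f2 := lin lls)); last 2 first.
- exact: cm.
- by apply: (IH (fun j => c (lift ord0 j))).
by move=> x; rewrite fE big_ord_recl.
Qed.

(** The powers of the radical decrease, so a map in rad^m has depth at least m; if
    it does not lie in all powers, there is a last one that contains it. *)
Lemma depth_ge m M N (f : {linear M -> N}) : (0 < m)%N -> C M -> C N ->
  in_rad_pow C m f -> ((Posz m)%:E <= depth C f)%E.
Proof.
move=> m0 CM CN fm; have fr := in_rad_pow_in_rad m0 CM CN fm.
rewrite /depth ifN; last by apply/asboolPn => /(_ fr).
case: asboolP => [_|fN]; first exact: leey.
case: xgetP => [d -> [d0 fd fdS]|no].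
  rewrite lee_fin lez_nat leqNgt; apply/negP => dm.
  by apply: fdS; exact: in_rad_pow_le fm.
case: fN => l l0; elim: l l0 => // -[_ _|l IH _]; first exact: in_rad_pow1.
by apply: contrapT => fN; apply: (no l.+1); split=> //; exact: IH.
Qed.

Lemma depth_ge0 M N (f : {linear M -> N}) : (0%:E <= depth C f)%E.
Proof.
by rewrite /depth; case: ifP => // _; case: ifP => // _; exact: leey.
Qed.

End Radical.

(** * Maps from projectives into the postprojective levels *)

Section Levels.
Variables (B : pzRingType) (n : nat) (S : 'I_n -> lmodType B).
Hypothesis Ssimple : forall i, is_simple (S i).
Variable C : lmodType B -> Prop.
Hypothesis C_fl : forall M, C M -> finite_length S M.
Hypothesis C_retract : forall M N, C M -> retract N M -> C N.
Hypothesis C_finite : is_finite_type C.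
Implicit Types M N L K X Y P : lmodType B.

Local Notation C_ k := (without_summands C (levels_below C k)).

Lemma level_remainder_retract k M N : C_ k M -> retract N M -> C_ k N.
Proof.
move=> [CM noM] rNM; split=> [|X Xk /summand_retract rXN]; first exact: C_retract rNM.
by apply: (noM X Xk); apply/summand_retract; exact: retract_trans rNM.
Qed.

Lemma level_remainder_succ k M : C_ k.+1 M -> C_ k M.
Proof. by move=> [CM noM]; split=> // X Xk; apply: noM; left. Qed.

Lemma level_generates k M : C_ k M -> generated (postprojective_level C k) M.
Proof.
have [r [X XP]] := C_finite.
apply: (splitting_projectives_generate Ssimple (r := r) (X := X)).
- by move=> N [/C_fl].
- exact: level_remainder_retract.
- by move=> N [CN _]; exact: XP.
Qed.

(** If b f a is an automorphism of X, then X is a retract of the indecomposable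
    module Y0, hence isomorphic to it, and also a retract of Y; so Y0 would be a summand of Y. *)
Lemma level_step_rad k Y0 Y (f : {linear Y0 -> Y}) :
  postprojective_level C k Y0 -> C_ k.+1 Y -> in_rad C f.
Proof.
move=> Y0k [CY noY]; have [Y0i [[CY0 _] _]] := Y0k; split=> // X CX [X0 _] a b hB.
have [v [vK _]] := bij_inverse (f := b \o f \o a) hB.
apply: (noY Y0); first by right.
apply/summand_retract; apply: (@retract_trans _ Y0 X Y).
  have rX : is_summand X Y0.
    by apply/summand_retract; exists a, (v \o b \o f) => x; exact: vK.
  have [L iso] := rX; have [X0'|L0] := Y0i.2 _ _ iso; first by case: X0.
  have [t /bij_inverse[u [tK uK]]] := iso.
  exists (pr1 X L \o t), (u \o in1 X L) => y /=.
  rewrite -[RHS]tK; congr (u _).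
  by rewrite [t y in RHS]surjective_pairing (L0 (t y).2).
by exists (f \o a), (v \o b) => x; exact: vK.
Qed.

Lemma in_rad_pow_sum (D : lmodType B -> Prop) m l P L Y
    (e : {linear L -> Y}) (h : {linear P -> L}) :
  (forall N (a : {linear P -> N}) (b : {linear N -> Y}),
     D N -> in_rad_pow C m (b \o a)) ->
  is_direct_sum_of D l L -> in_rad_pow C m (e \o h).
Proof.
move=> DP; elim: l L e h => [|l IHl] L e h /=.
  by move=> L0; apply: in_rad_pow_zero => x; rewrite /= (L0 (h x)) linear0.
case=> N [L' [DN DL' [t /bij_inverse[u [tK uK]]]]].
apply: (in_rad_pow_add (f1 := e \o u \o in1 N L' \o (pr1 N L' \o t \o h))
                       (f2 := e \o u \o in2 N L' \o (pr2 N L' \o t \o h))).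
- move=> x; rewrite /= -!linearD -[in LHS](tK (h x)); congr (e (u _)).
  by rewrite [LHS]surjective_pairing; congr pair; rewrite ?addr0 ?add0r.
- exact: DP.
- exact: IHl.
Qed.

(** Each step from C_k to C_(k+1) lifts the map to a direct sum of modules of P_k
    and contributes one radical factor. *)
Lemma projective_to_level k P Y (g : {linear P -> Y}) :
  is_projective P -> C P -> C_ k.+1 Y -> in_rad_pow C k.+1 g.
Proof.
move=> Pproj CP; elim: k Y g => [|k IH] Y g Yk.
all: have [l [L [e [DL eE]]]] := level_generates (level_remainder_succ Yk).
all: have [h hP] := Pproj _ _ e g eE.
all: apply: (in_rad_pow_ext (f := e \o h)) => //; apply: in_rad_pow_sum DL => N a b Nk.
  by apply: in_rad_pow1; apply: in_rad_pre => //; exact: level_step_rad Nk Yk.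
apply: in_rad_pow_rad; first exact: level_step_rad Nk Yk.
by apply: IH; have [_ []] := Nk.
Qed.

End Levels.

Theorem proposition4p6 (R : comNzRingType) (A : algType R) (n : nat)
    (S P Delta : 'I_n -> lmodType A^c)
    (top : forall i : 'I_n, {linear P i -> S i})
    (pi : forall i : 'I_n, {linear P i -> Delta i})
    (hA : is_artin_algebra A)
    (hS : simple_representatives S)
    (hP : forall i : 'I_n, is_projective_cover (top i))
    (hDelta : forall i : 'I_n, is_largest_factor_le S i (pi i))
    (hqh : is_quasi_hereditary S Delta)
    (hfin : is_finite_type (filtered Delta)) :
  ((Posz (postprojective_length (filtered Delta)))%:E <=
    \big[maxe/-oo]_(i < n) depth (filtered Delta) (pi i))%E.
Proof.
have [Ss Sd _] := hS; have [_ FA] := hqh.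
set C := filtered Delta.
have C_fl : forall M, C M -> finite_length S M := filtered_fl Ss Sd hP hDelta.
have C_retract M N : C M -> retract N M -> C N.
  by move=> CM r; exact: (filtered_retract Ss Sd hP hDelta r CM).
have CP i : C (P i).
  by have [Pfg Pproj _ _] := hP i; exact: (filtered_projective Ss Sd hP hDelta).
have CD i : C (Delta i).
  exact: (top_layer_filtered Ss hP hDelta (top_layer_Delta Ss Sd hP hDelta i)).
have bound i m : (m%:Z%:E <= depth C (pi i))%E ->
    (m%:Z%:E <= \big[maxe/-oo]_(i < n) depth C (pi i))%E.
  move=> /Order.POrderTheory.le_trans; apply.
  exact: (Order.TotalTheory.le_bigmax _ (fun i => depth C (pi i))).
have [m mE] : exists m, m = postprojective_length C by exists (postprojective_length C).
rewrite -mE; case: m mE => [_|m mE].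
  have [[|i w] FAw] := FA; last by apply: (bound i); exact: depth_ge0.
  have /eqP : (1 : A) = 0 := FAw (1 : A^c).
  by rewrite oner_eq0.
have [X Xm] : exists X, postprojective_level C m.+1 X.
  by move: mE; rewrite /postprojective_length; case: xgetP => [k _ [kX _] ->|] //.
have [[X0 _] [Xm1 _]] := Xm; have [[[|i w] Xw] _] := Xm1; first by case: X0.
have [M' [_ [g [_ gE _ _]]]] := Xw.
have [_ Pproj _ _] := hP i.
have [h hE] := Pproj _ _ g (pi i) gE.
apply: (bound i); apply: (depth_ge Ss C_fl) => //.
apply: (in_rad_pow_ext (f := g \o h)) => //; apply: in_rad_pow_post => //.
exact: (projective_to_level Ss C_fl C_retract hfin).
Qed.
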